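(* $\mathcal{K}^\infty$ is closed under the smooth functional calculus of self-adjoint elements: for any self-adjoint $c\in\mathcal{K}^\infty$ and any smooth function $f$ on a neighborhood (in $\mathbb{R}$) of the spectrum of $c$ such that $f(0)=0$, we have $f(c)\in\mathcal{K}^\infty$.
   Context: $H$ is a separable infinite-dimensional complex Hilbert space with a fixed orthonormal basis $\{E_k\}_{k\ge0}$; $P_{k,l}$ is the operator with $P_{k,l}E_l=E_k$ and $P_{k,l}E_m=0$ for $m\ne l$. $\mathcal{K}^\infty$ (smooth compact operators) is the set of operators $c=\sum_{k,l\ge0}c_{k,l}P_{k,l}$ with rapidly decaying coefficients: $\sup_{k,l}(1+k)^M(1+l)^N|c_{k,l}|<\infty$ for all $M,N\ge0$. $f(c)$ denotes the continuous functional calculus of the self-adjoint operator $c$. *)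

(* Defs.v *)
From mathcomp Require Import all_boot all_order all_algebra.
From mathcomp Require Import all_classical all_reals all_analysis.
From mathcomp Require Import complex.

Set Implicit Arguments.
Unset Strict Implicit.
Unset Printing Implicit Defensive.

Import Order.TTheory GRing.Theory Num.Theory Num.Def.
Import numFieldNormedType.Exports.

Local Open Scope classical_set_scope.
Local Open Scope ring_scope.
Local Open Scope complex_scope.

(* A complex Hilbert space is a completeNormedModType over R[i] whose norm is
   induced by a positive definite hermitian form (linear in its first
   argument). *)
Definition hilbert_form (R : realType) (H : completeNormedModType R[i])
    (dot : {dot H for conjC}) : Prop :=
  forall x : H, `|x| ^+ 2 = dot x x.

(* Being indexed by nat, such a basis makes H separable and
   infinite-dimensional. *)
Definition orthonormal_basis (R : realType) (H : completeNormedModType R[i])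
    (dot : {dot H for conjC}) (E : nat -> H) : Prop :=
  (forall k l, dot (E k) (E l) = (k == l)%:R) /\
  (forall x : H, series (fun k => dot x (E k) *: E k) n @[n --> \oo] --> x).

Definition bounded_operator (R : realType) (H : completeNormedModType R[i])
    (T : H -> H) : Prop :=
  linear T /\ continuous T.

(* For bounded operators this says that S is the adjoint of T. *)
Definition adjoint_to (R : realType) (H : completeNormedModType R[i])
    (dot : {dot H for conjC}) (T S : H -> H) : Prop :=
  forall x y : H, dot (T x) y = dot x (S y).

Definition self_adjoint (R : realType) (H : completeNormedModType R[i])
    (dot : {dot H for conjC}) (T : H -> H) : Prop :=
  bounded_operator T /\ adjoint_to dot T T.

(* Convergence in operator norm: |T_n - T| <= e, with |A| <= e spelled out as
   |A x| <= e |x| for all x. *)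
Definition opnorm_cvg (R : realType) (H : completeNormedModType R[i])
    (Tn : nat -> H -> H) (T : H -> H) : Prop :=
  forall e : R, 0 < e -> \forall n \near \oo,
    forall x : H, `|Tn n x - T x| <= e%:C * `|x|.

Definition matrix_unit (R : realType) (H : completeNormedModType R[i])
    (dot : {dot H for conjC}) (E : nat -> H) (k l : nat) : H -> H :=
  fun x => dot x (E l) *: E k.

Definition rapidly_decaying (R : realType) (a : nat -> nat -> R[i]) : Prop :=
  forall M N : nat, exists B : R, forall k l : nat,
    (1 + k)%:R ^+ M * (1 + l)%:R ^+ N * `|a k l| <= B%:C.

(* The double series converges absolutely in operator norm, so summing it along
   squares loses nothing. *)
Definition smooth_compact (R : realType) (H : completeNormedModType R[i])
    (dot : {dot H for conjC}) (E : nat -> H) (T : H -> H) : Prop :=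
  bounded_operator T /\
  exists a : nat -> nat -> R[i], rapidly_decaying a /\
    opnorm_cvg
      (fun n x => \sum_(k < n) \sum_(l < n) a k l *: matrix_unit dot E k l x) T.

Definition spectrum (R : realType) (H : completeNormedModType R[i])
    (T : H -> H) : set R[i] :=
  [set z | ~ exists S : H -> H, [/\ bounded_operator S,
      forall x : H, S (T x - z *: x) = x &
      forall x : H, T (S x) - z *: S x = x]].

(* The spectrum of a self-adjoint operator, viewed inside R. *)
Definition real_spectrum (R : realType) (H : completeNormedModType R[i])
    (T : H -> H) : set R :=
  [set t : R | spectrum T t%:C].

(* R[i]^o only serves to give R[i] its topology. *)
Definition continuous_on (R : realType) (A : set R) (f : R -> R[i]) : Prop :=
  {within A, continuous (f : R -> R[i]^o)}.

Definition smooth_on (R : realType) (U : set R) (f : R -> R[i]) : Prop :=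
  forall (n : nat) (t : R), U t ->
    derivable (derive1n n (fun s => complex.Re (f s))) t 1 /\
    derivable (derive1n n (fun s => complex.Im (f s))) t 1.

(* Phi is the continuous unital *-homomorphism C(sigma(T)) -> B(H) sending the
   inclusion sigma(T) -> C to T.  Elements of C(sigma(T)) are represented by
   total functions, only their values on sigma(T) being relevant; Phi is
   unconstrained on functions that are not continuous on sigma(T). *)
Record is_continuous_calculus (R : realType) (H : completeNormedModType R[i])
    (dot : {dot H for conjC}) (T : H -> H)
    (Phi : (R -> R[i]) -> H -> H) : Prop := IsContinuousCalculus {
  calculus_bounded : forall f, continuous_on (real_spectrum T) f ->
    bounded_operator (Phi f);
  calculus_ext : forall f g, continuous_on (real_spectrum T) f ->
    continuous_on (real_spectrum T) g ->
    (forall t, real_spectrum T t -> f t = g t) ->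
    forall x, Phi f x = Phi g x;
  calculus_add : forall f g, continuous_on (real_spectrum T) f ->
    continuous_on (real_spectrum T) g ->
    forall x, Phi (fun t => f t + g t) x = Phi f x + Phi g x;
  calculus_scale : forall (z : R[i]) f, continuous_on (real_spectrum T) f ->
    forall x, Phi (fun t => z * f t) x = z *: Phi f x;
  calculus_mul : forall f g, continuous_on (real_spectrum T) f ->
    continuous_on (real_spectrum T) g ->
    forall x, Phi (fun t => f t * g t) x = Phi f (Phi g x);
  calculus_one : forall x, Phi (fun=> 1) x = x;
  calculus_star : forall f, continuous_on (real_spectrum T) f ->
    adjoint_to dot (Phi f) (Phi (fun t => conjC (f t)));
  calculus_id : forall x, Phi (fun t => t%:C) x = T x;
  calculus_norm : forall f (M : R), 0 <= M ->
    continuous_on (real_spectrum T) f ->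
    (forall t, real_spectrum T t -> `|f t| <= M%:C) ->
    forall x, `|Phi f x| <= M%:C * `|x| }.

(* The functional calculus of a self-adjoint operator T, [f |-> f(T)].  It
   exists and is unique (on functions continuous on the spectrum) by the
   spectral theorem; the default value of xget is therefore irrelevant, and it
   is chosen outside the compact operators. *)
Definition continuous_calculus (R : realType)
    (H : completeNormedModType R[i]) (dot : {dot H for conjC}) (T : H -> H) :
    (R -> R[i]) -> H -> H :=
  @xget ((R -> R[i]) -> H -> H) (fun _ x => x) [set Phi | is_continuous_calculus dot T Phi].

(* Main.v *)
Require Import Defs.
From mathcomp Require Import all_boot all_order all_algebra.
From mathcomp Require Import all_classical all_reals all_analysis.
From mathcomp Require Import complex.
From mathcomp Require Import ring lra.
Import Order.TTheory GRing.Theory Num.Theory Num.Def.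
Import numFieldNormedType.Exports.
Local Open Scope classical_set_scope.
Local Open Scope ring_scope.

(* Write f(t) = z t + t h(t) t with z = f'(0); h is continuous on the spectrum
   of c, the only delicate point being 0, where Taylor's formula applies.  Then
   f(c) = z c + c h(c) c, so that
     <f(c) E_l, E_k> = z <c E_l, E_k> + <h(c) c E_l, c E_k>,
   and the last term is at most |h(c)| |c E_l| |c E_k|, which decays rapidly
   because |c E_k| does.  A bounded operator with a rapidly decaying matrix is
   the norm limit of its square truncations.

   That the functional calculus exists is part of the claim.  For a self-adjoint
   T and a polynomial p, |p(T)| is at most the supremum of |p| on the approximate
   spectrum A of T, which contains 0 when T = c because |c E_k| tends to 0.  By
   Bernstein approximation (after a Tietze extension from A), the map p -> p(T)
   extends to all functions that are continuous on A. *)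

(** Two factors of t are split off because the decay must hold in both indices at once: from f(c) =
    c g(c) alone only the row index k would profit, whereas in c h(c) c one copy of c acts on E_l
    and the other is moved to E_k, so that h(c) only has to be bounded. Dividing by t^2 is possible
    because 0 lies in the spectrum of c, hence in U, where f is smooth. Existence of the calculus
    cannot be skipped: [continuous_calculus] is chosen by [xget], and without an admissible choice
    it would return the identity for every f, which is not compact. The norm estimate for
    polynomials is obtained by contradiction: an operator norm N larger than the supremum of |p|
    would make conj(p) p - N^2 free of zeros on the approximate spectrum, and factoring this
    polynomial over the complex numbers would then allow N to be lowered. *)

Section Development.
Local Open Scope complex_scope.
Set Implicit Arguments.
Unset Strict Implicit.
Unset Printing Implicit Defensive.

(** * The real-valued norm *)

(* Norms over R[i] take values in R[i]; this is the norm as a real number. *)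
Definition rnorm (R : realType) (V : normedZmodType R[i]) (x : V) : R :=
  complex.Re `|x|.
Arguments rnorm {R V} x.

Section RealNorm.
Context {R : realType}.

Section Zmod.
Context {V : normedZmodType R[i]}.
Implicit Types x y : V.

Lemma norm_rnorm x : `|x| = (rnorm x)%:C.
Proof.
have: `|x| \is Num.real by apply: normr_real.
by move/RRe_real.
Qed.

Lemma rnorm_le x (e : R) : (rnorm x <= e) = (`|x| <= e%:C).
Proof. by rewrite norm_rnorm lecR. Qed.

Lemma rnorm_ge0 x : 0 <= rnorm x.
Proof. by rewrite -lecR -norm_rnorm normr_ge0. Qed.

Lemma rnormD x y : rnorm (x + y) <= rnorm x + rnorm y.
Proof. by rewrite rnorm_le rmorphD /= -!norm_rnorm ler_normD. Qed.

Lemma rnormN x : rnorm (- x) = rnorm x.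
Proof. by rewrite /rnorm normrN. Qed.

Lemma rnormB x y : rnorm (x - y) = rnorm (y - x).
Proof. by rewrite /rnorm distrC. Qed.

Lemma rnorm_dist x y z : rnorm (x - y) <= rnorm (x - z) + rnorm (z - y).
Proof. by have := rnormD (x - z) (z - y); rewrite addrA subrK. Qed.

Lemma rnorm0 : rnorm (0 : V) = 0.
Proof. by rewrite /rnorm normr0. Qed.

Lemma rnorm0_eq0 x : rnorm x = 0 -> x = 0.
Proof. by move=> x0; apply/normr0_eq0; rewrite norm_rnorm x0. Qed.

Lemma rnorm_gt0 x : x != 0 -> 0 < rnorm x.
Proof.
move=> x0; rewrite lt_neqAle rnorm_ge0 andbT eq_sym.
by apply: contra x0 => /eqP/rnorm0_eq0/eqP.
Qed.

Lemma rnorm_sum (I : Type) (r : seq I) (P : pred I) (F : I -> V) :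
  rnorm (\sum_(i <- r | P i) F i) <= \sum_(i <- r | P i) rnorm (F i).
Proof.
elim/big_ind2: _ => [|x a y b xa yb|//]; first by rewrite rnorm0.
by apply: le_trans (rnormD _ _) _; apply: lerD.
Qed.

(** The factor [C] lets approximation arguments end without normalising their error. Its sign is
    arbitrary, hence the division by |C| + 1. *)
Lemma rnorm_eps0 x (C : R) : (forall e : R, 0 < e -> rnorm x <= e * C) -> x = 0.
Proof.
move=> xe; apply: rnorm0_eq0; apply/eqP; rewrite eq_le rnorm_ge0 andbT.
apply/ler_addgt0Pl => e e0; rewrite addr0.
have C1 : 0 < `|C| + 1 by rewrite ltr_wpDl.
have := xe _ (divr_gt0 e0 C1) => /le_trans; apply.
rewrite mulrAC ler_pdivrMr // ler_pM2l //.
by rewrite (le_trans (ler_norm C)) // lerDl.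
Qed.
End Zmod.

Lemma rnormZ (V : normedModType R[i]) (a : R[i]) (x : V) :
  rnorm (a *: x) = rnorm a * rnorm x.
Proof. by apply: complexI; rewrite rmorphM /= -!norm_rnorm normrZ. Qed.

Lemma rnormM (a b : R[i]) : rnorm (a * b) = rnorm a * rnorm b.
Proof. by apply: complexI; rewrite rmorphM /= -!norm_rnorm normrM. Qed.

Lemma rnormC (t : R) : rnorm t%:C = `|t|.
Proof.
by rewrite /rnorm normc_def /= expr0n /= addr0 sqrtr_sqr.
Qed.

Lemma rnormJ (z : R[i]) : rnorm (conjC z) = rnorm z.
Proof. by rewrite /rnorm norm_conjC. Qed.

Lemma conjCR (t : R) : conjC t%:C = t%:C.
Proof. exact: conjc_real. Qed.

Lemma mul_conjE (z : R[i]) : z * conjC z = (rnorm z ^+ 2)%:C.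
Proof. by rewrite -normCK norm_rnorm rmorphXn. Qed.

Lemma rnorm_ReIm (z : R[i]) : rnorm z ^+ 2 = complex.Re z ^+ 2 + complex.Im z ^+ 2.
Proof.
by rewrite /rnorm normc_def /= sqr_sqrtr // addr_ge0 // sqr_ge0.
Qed.

Lemma rnorm_le_ReIm (z : R[i]) : rnorm z <= `|complex.Re z| + `|complex.Im z|.
Proof.
rewrite -(@ler_pXn2r _ 2) ?nnegrE ?rnorm_ge0 ?addr_ge0 //.
rewrite rnorm_ReIm sqrrD !real_normK ?num_real //.
have h : 0 <= `|complex.Re z| * `|complex.Im z| by rewrite mulr_ge0.
by lra.
Qed.

Lemma normRe_le (z : R[i]) : `|complex.Re z| <= rnorm z.
Proof. by rewrite -lecR -norm_rnorm; exact: normc_ge_Re. Qed.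

Lemma normIm_le (z : R[i]) : `|complex.Im z| <= rnorm z.
Proof.
rewrite -(@ler_pXn2r _ 2) ?nnegrE ?rnorm_ge0 //.
by rewrite rnorm_ReIm real_normK ?num_real // lerDr sqr_ge0.
Qed.

Lemma cvg_rnormP (V : normedModType R[i]) (u : nat -> V) (l : V) :
  u n @[n --> \oo] --> l <->
  forall e : R, 0 < e -> \forall n \near \oo, rnorm (l - u n) <= e.
Proof.
split=> [/cvgrPdist_le ul e e0|ul].
  have := ul e%:C; rewrite ltcR => /(_ e0).
  by apply: filterS => n; rewrite rnorm_le.
apply/cvgrPdist_le => e e0.
have er : (complex.Re e)%:C = e by apply: RRe_real; exact: gtr0_real.
have : 0 < complex.Re e by rewrite -ltcR er.
by move=> /ul; apply: filterS => n; rewrite rnorm_le er.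
Qed.

(** Closed balls about [x] are closed; norm estimates are carried to limits in this form. *)
Lemma cvg_unique_rnorm (V : normedModType R[i]) (u : nat -> V) (l : V) (C : R) x :
  u n @[n --> \oo] --> l -> (\forall n \near \oo, rnorm (x - u n) <= C) ->
  rnorm (x - l) <= C.
Proof.
move=> /cvg_rnormP ul uC; apply/ler_addgt0Pr => e e0.
have [n [h1 h2]] := filter_ex (filterI (ul _ e0) uC).
apply: le_trans (rnorm_dist x l (u n)) _; apply: lerD => //.
by rewrite rnormB.
Qed.

Lemma near_rnorm (V : normedModType R[i]) (x : V) (e : R) :
  0 < e -> \forall y \near x, rnorm (x - y) <= e.
Proof.
move=> e0; near=> y; rewrite rnorm_le; near: y.
by apply: cvgr_dist_le; [exact: cvg_id|rewrite ltcR].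
Unshelve. all: by end_near. Qed.

Definition bounded_by {V W : normedZmodType R[i]} (T : V -> W) (K : R) :=
  forall x, rnorm (T x) <= K * rnorm x.

End RealNorm.
Arguments bounded_by {R V W}.

(** * Bounded operators and the hermitian form *)

Section LinearOp.
Context {K : numDomainType} {V W : lmodType K} (T : V -> W) (linT : linear T).
Lemma linearpD x y : T (x + y) = T x + T y.
Proof. by have := linT 1 x y; rewrite !scale1r. Qed.
Lemma linearp0 : T 0 = 0.
Proof. by apply: (addrI (T 0)); rewrite -linearpD !addr0. Qed.
Lemma linearpZ a x : T (a *: x) = a *: T x.
Proof. by have := linT a x 0; rewrite !addr0 linearp0 addr0. Qed.
Lemma linearpB x y : T (x - y) = T x - T y.
Proof. by rewrite -scaleN1r linearpD linearpZ scaleN1r. Qed.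
Lemma linearp_sum (I : Type) (r : seq I) (P : pred I) (F : I -> V) :
  T (\sum_(i <- r | P i) F i) = \sum_(i <- r | P i) T (F i).
Proof. exact: (big_morph T linearpD linearp0). Qed.
End LinearOp.

Section BoundedOp.
Context {R : realType} {H : completeNormedModType R[i]}.
Implicit Types T : H -> H.

Lemma bounded_operatorP T :
  bounded_operator T <-> linear T /\ exists2 K, 0 <= K & bounded_by T K.
Proof.
split=> [[linT cT]|[linT [K K0 TK]]]; split=> //.
  have := cT 0; move/cvgrPdist_le => /(_ 1 ltr01).
  rewrite /= linearp0 // => /nbhs_normP[d /= d0 dT].
  have dr : (complex.Re d)%:C = d by apply: RRe_real; exact: gtr0_real.
  set r := complex.Re d in dr.
  have r0 : 0 < r by rewrite -ltcR dr.
  (* T maps the ball of radius r into the closed unit ball. A nonzero vector rescaled to norm r / 2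
     lies in that ball, whence the factor 2 / r. *)
  exists (2 / r); first by rewrite divr_ge0 // ltW.
  move=> x; have [->|x0] := eqVneq x 0.
    by rewrite linearp0 // !rnorm0 mulr0.
  have nx := rnorm_gt0 x0.
  have t0 : 0 < r / 2 / rnorm x by rewrite divr_gt0 // divr_gt0.
  have := dT (((r / 2 / rnorm x)%:C) *: x).
  rewrite /ball_ /= !sub0r !normrN (linearpZ linT).
  rewrite -dr !norm_rnorm ltcR rnormZ rnormC gtr0_norm //.
  rewrite divfK ?gt_eqF // => /(_ _)/wrap[]; first lra.
  rewrite rnormZ rnormC gtr0_norm // => h1.
  have h : r / 2 / rnorm x * rnorm (T x) <= 1 by rewrite -lecR.
  have e : rnorm (T x) = (2 / r * rnorm x) * (r / 2 / rnorm x * rnorm (T x)).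
    by field; rewrite !gt_eqF.
  by rewrite e ler_piMr // mulr_ge0 ?divr_ge0 // ltW.
move=> x; apply/cvgrPdist_le => e e0.
have er : (complex.Re e)%:C = e by apply: RRe_real; exact: gtr0_real.
have re0 : 0 < complex.Re e by rewrite -ltcR er.
have K1 : 0 < K + 1 by rewrite ltr_wpDl.
near=> y.
rewrite -er -linearpB // -rnorm_le (le_trans (TK _)) //.
apply: (@le_trans _ _ ((K + 1) * rnorm (x - y))).
  by rewrite ler_wpM2r ?rnorm_ge0 // lerDl.
rewrite mulrC -ler_pdivlMr //.
by near: y; apply: near_rnorm; rewrite divr_gt0.
Unshelve. all: by end_near. Qed.

Lemma bounded_operator_id : bounded_operator (@id H).
Proof.
apply/bounded_operatorP; split; first by move=> a x y.
exists 1; first exact: ler01.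
by move=> x; rewrite mul1r.
Qed.

Lemma bounded_operator_comp (S T : H -> H) :
  bounded_operator S -> bounded_operator T -> bounded_operator (S \o T).
Proof.
move=> [lS cS] [lT cT]; split; first by move=> a x y /=; rewrite lT lS.
by move=> x; apply: continuous_comp; [exact: cT | exact: cS].
Qed.

Lemma bounded_operatorD (S T : H -> H) :
  bounded_operator S -> bounded_operator T -> bounded_operator (fun x => S x + T x).
Proof.
move=> /bounded_operatorP[lS [K K0 SK]] /bounded_operatorP[lT [L L0 TL]].
apply/bounded_operatorP; split.
  by move=> a x y; rewrite lS lT scalerDr addrACA.
exists (K + L) => [|x]; first exact: addr_ge0.
by rewrite mulrDl (le_trans (rnormD _ _)) // lerD.
Qed.

Lemma bounded_operatorZ (a : R[i]) (T : H -> H) :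
  bounded_operator T -> bounded_operator (fun x => a *: T x).
Proof.
move=> /bounded_operatorP[lT [L L0 TL]].
apply/bounded_operatorP; split.
  by move=> b x y; rewrite lT scalerDr !scalerA mulrC.
exists (rnorm a * L) => [|x]; first by rewrite mulr_ge0 ?rnorm_ge0.
by rewrite rnormZ -mulrA ler_wpM2l ?rnorm_ge0.
Qed.

End BoundedOp.

Section Hilbert.
Context {R : realType} {H : completeNormedModType R[i]} {dot : {dot H for conjC}}.
Hypothesis hdot : hilbert_form dot.
Implicit Types x y z : H.

Lemma dotxx x : dot x x = (rnorm x ^+ 2)%:C.
Proof. by rewrite -hdot norm_rnorm rmorphXn. Qed.
Lemma dotC x y : dot y x = conjC (dot x y).
Proof. by rewrite hermC expr0 mul1r. Qed.
Lemma dotDl x y z : dot (x + y) z = dot x z + dot y z.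
Proof. exact: linearDl. Qed.
Lemma dotDr x y z : dot x (y + z) = dot x y + dot x z.
Proof. exact: linearDr. Qed.
Lemma dotBl x y z : dot (x - y) z = dot x z - dot y z.
Proof. exact: linearBl. Qed.
Lemma dotBr x y z : dot x (y - z) = dot x y - dot x z.
Proof. exact: linearBr. Qed.
Lemma dotZl a x y : dot (a *: x) y = a * dot x y.
Proof. exact: linearZl_LR. Qed.
Lemma dotZr a x y : dot x (a *: y) = conjC a * dot x y.
Proof. exact: linearZr_LR. Qed.
Lemma dot0l y : dot 0 y = 0.
Proof. exact: linear0l. Qed.
Lemma dot0r y : dot y 0 = 0.
Proof. exact: linear0r. Qed.
Lemma dot_suml (I : Type) (r : seq I) (P : pred I) (F : I -> H) y :
  dot (\sum_(i <- r | P i) F i) y = \sum_(i <- r | P i) dot (F i) y.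
Proof. exact: (big_morph (fun x => dot x y) (fun a b => dotDl a b y) (dot0l y)). Qed.

Lemma dot_CS x y : rnorm (dot x y) <= rnorm x * rnorm y.
Proof.
have [->|y0] := eqVneq y 0; first by rewrite dot0r !rnorm0 mulr0.
have ny := rnorm_gt0 y0.
pose b := rnorm y ^+ 2; have b0 : 0 < b by rewrite exprn_gt0.
(* Up to the factor |y|^2, which avoids a division, [z] is the component of x orthogonal to y; the
   inequality is the positivity of <z, z>. *)
pose z := b%:C *: x - dot x y *: y.
have : dot z z = (b * (b * rnorm x ^+ 2 - rnorm (dot x y) ^+ 2))%:C.
  rewrite /z dotBl !dotBr !dotZl !dotZr [dot y y]dotxx -/b [dot x x]dotxx.
  rewrite conjCR (dotC x y); move: b (rnorm x ^+ 2) {b0 z} => b a.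
  have -> : (b * (b * a - rnorm (dot x y) ^+ 2))%:C =
      b%:C * (b%:C * a%:C - (rnorm (dot x y) ^+ 2)%:C).
    by rewrite -rmorphM -rmorphB -rmorphM.
  by rewrite -mul_conjE; ring.
rewrite dotxx => /complexI e.
have : 0 <= b * (b * rnorm x ^+ 2 - rnorm (dot x y) ^+ 2).
  by rewrite -e exprn_ge0 ?rnorm_ge0.
rewrite pmulr_rge0 // subr_ge0 /b mulrC -exprMn ler_pXn2r //.
- by rewrite nnegrE rnorm_ge0.
- by rewrite nnegrE mulr_ge0 ?rnorm_ge0.
Qed.

Lemma dot_cvgl (u : nat -> H) l y :
  u n @[n --> \oo] --> l -> (dot (u n) y : R[i]^o) @[n --> \oo] --> (dot l y : R[i]^o).
Proof.
move=> /cvg_rnormP ul; apply/cvg_rnormP => e e0.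
have K1 : 0 < rnorm y + 1 by rewrite ltr_wpDl ?rnorm_ge0.
have := ul _ (divr_gt0 e0 K1); apply: filterS => n h.
rewrite -dotBl; apply: le_trans (dot_CS _ _) _.
apply: le_trans (_ : rnorm (l - u n) * (rnorm y + 1) <= _).
  by rewrite ler_wpM2l ?rnorm_ge0 // lerDl.
by rewrite -ler_pdivlMr.
Qed.

End Hilbert.

(** * Polynomials of a self-adjoint operator *)

Definition polyop {K : numDomainType} {V : lmodType K} (T : V -> V)
  (p : {poly K}) (x : V) : V := \sum_(i < size p) p`_i *: iter i T x.

Definition bounded_below {R : realType} {V : normedZmodType R[i]} (T : V -> V) :=
  exists2 d : R, 0 < d & forall x, d * rnorm x <= rnorm (T x).

(* For a self-adjoint T this is the whole spectrum, but only the inclusion in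
   the spectrum is needed: closedness, boundedness and the norm estimate
   [polyop_norm] then require no operator to be inverted. *)
Definition approx_spectrum {R : realType} {H : completeNormedModType R[i]}
  (T : H -> H) : set R := [set t | ~ bounded_below (fun x => T x - t%:C *: x)].

Section PolyOp.
Context {K : numDomainType} {V : lmodType K} (T : V -> V) (linT : linear T).
Implicit Types (p q : {poly K}).

Lemma polyop_widen n p x : (size p <= n)%N ->
  polyop T p x = \sum_(i < n) p`_i *: iter i T x.
Proof.
move=> pn; rewrite /polyop (big_ord_widen n (fun i => p`_i *: iter i T x)) //.
rewrite big_mkcond /=; apply: eq_bigr => i _; case: ltnP => // h.
by rewrite nth_default // scale0r.
Qed.

Lemma polyop0 x : polyop T 0 x = 0.
Proof. by rewrite /polyop size_poly0 big_ord0. Qed.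

Lemma polyopD p q x : polyop T (p + q) x = polyop T p x + polyop T q x.
Proof.
pose n := maxn (size p) (size q).
rewrite (@polyop_widen n) ?size_polyD // (@polyop_widen n p) ?leq_maxl //.
rewrite (@polyop_widen n q) ?leq_maxr // -big_split /=.
by apply: eq_bigr => i _; rewrite coefD scalerDl.
Qed.

Lemma polyopZ a p x : polyop T (a *: p) x = a *: polyop T p x.
Proof.
rewrite (@polyop_widen (size p)) ?size_scale_leq // /polyop scaler_sumr.
by apply: eq_bigr => i _; rewrite coefZ scalerA.
Qed.

Lemma polyopB p q x : polyop T (p - q) x = polyop T p x - polyop T q x.
Proof. by rewrite -[- q]scaleN1r polyopD polyopZ scaleN1r. Qed.

Lemma polyopC a x : polyop T a%:P x = a *: x.
Proof.
by rewrite (@polyop_widen 1) ?size_polyC_leq1 // big_ord1 coefC.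
Qed.

Lemma polyopMX p x : polyop T (p * 'X) x = polyop T p (T x).
Proof.
rewrite (@polyop_widen (size p).+1); last first.
  by rewrite (leq_trans (size_polyMleq _ _)) // size_polyX addn2.
rewrite big_ord_recl /= coefMX /= scale0r add0r /polyop.
by apply: eq_bigr => i _; rewrite coefMX /= -iterSr.
Qed.

Lemma polyopX x : polyop T 'X x = T x.
Proof. by rewrite -['X]mul1r polyopMX polyopC scale1r. Qed.

Lemma polyop_linear p : linear (polyop T p).
Proof.
elim/poly_ind: p => [|p c IH] a x y; first by rewrite !polyop0 scaler0 addr0.
by rewrite !polyopD !polyopMX linT IH !polyopC !scalerDr addrACA scalerA mulrC -scalerA.
Qed.

Lemma polyop_comm p x : polyop T p (T x) = T (polyop T p x).
Proof.
elim/poly_ind: p x => [|p c IH] x; first by rewrite !polyop0 linearp0.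
by rewrite !polyopD !polyopMX IH !polyopC (linearpD linT) (linearpZ linT).
Qed.

Lemma polyopM p q x : polyop T (p * q) x = polyop T p (polyop T q x).
Proof.
elim/poly_ind: p q x => [|p c IH] q x; first by rewrite mul0r !polyop0.
rewrite mulrDl !polyopD -mulrA ['X * q]mulrC (IH (q * 'X)) !polyopMX !polyopC.
rewrite -!polyop_comm //.
by rewrite mul_polyC polyopZ.
Qed.

End PolyOp.

(** * Norms of polynomials of a self-adjoint operator, and its approximate spectrum *)

Section SelfAdjoint.
Context {R : realType} {H : completeNormedModType R[i]} {dot : {dot H for conjC}}.
Hypothesis hdot : hilbert_form dot.
Variable T : H -> H.
Hypothesis Tsa : self_adjoint dot T.
Implicit Types (p q : {poly R[i]}).

Lemma self_adjoint_linear : linear T. Proof. by case: Tsa => -[]. Qed.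

Lemma polyop_bounded p : bounded_operator (polyop T p).
Proof.
elim/poly_ind: p => [|p c IH].
  apply/bounded_operatorP; split; first exact: polyop_linear self_adjoint_linear _.
  by exists 0 => // x; rewrite polyop0 rnorm0 mul0r.
have -> : polyop T (p * 'X + c%:P) = fun x => (polyop T p \o T) x + c *: x.
  by apply/funext => x; rewrite polyopD polyopMX polyopC.
apply: bounded_operatorD.
  by apply: bounded_operator_comp => //; case: Tsa.
exact: bounded_operatorZ bounded_operator_id.
Qed.

Lemma polyop_adj p : adjoint_to dot (polyop T p) (polyop T (map_poly conjC p)).
Proof.
elim/poly_ind: p => [|p c IH] x y.
  by rewrite rmorph0 !polyop0 dot0l dot0r.
rewrite rmorphD rmorphM /= map_polyX map_polyC /= !polyopD !polyopMX !polyopC.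
rewrite dotDl dotDr IH (proj2 Tsa) dotZl dotZr conjCK.
by rewrite polyop_comm //; exact: self_adjoint_linear.
Qed.

Lemma conj_polyK p : map_poly conjC (map_poly conjC p) = p.
Proof. by rewrite -map_poly_comp map_poly_id // => z _ /=; rewrite conjCK. Qed.

Lemma horner_conj p (t : R) : (map_poly conjC p).[t%:C] = conjC p.[t%:C].
Proof. by rewrite -{1}(conjCR t) horner_map. Qed.

(* [p(T)] is normal. *)
Lemma rnorm_polyop_conj p x :
  rnorm (polyop T (map_poly conjC p) x) = rnorm (polyop T p x).
Proof.
apply: (@pexpIrn _ 2) => //; rewrite ?nnegrE ?rnorm_ge0 //; apply: complexI.
rewrite -(dotxx hdot (polyop T p x)).
rewrite -(dotxx hdot (polyop T (map_poly conjC p) x)).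
rewrite polyop_adj polyop_adj conj_polyK.
rewrite -(polyopM self_adjoint_linear) -(polyopM self_adjoint_linear).
by rewrite mulrC.
Qed.

(** Since <Tx, x> is real, <(T - z)x, x> has imaginary part -Im(z) |x|^2, and the Cauchy-Schwarz
    inequality bounds it by |(T - z)x| |x|. *)
Lemma bounded_below_imaginary (z : R[i]) : complex.Im z != 0 ->
  bounded_below (fun x => T x - z *: x).
Proof.
move=> z0; exists `|complex.Im z|; first by rewrite normr_gt0.
move=> x; have [->|x0] := eqVneq x 0.
  by rewrite rnorm0 mulr0 rnorm_ge0.
rewrite -(ler_pM2r (rnorm_gt0 x0)) -mulrA.
apply: le_trans (dot_CS hdot _ _); apply: le_trans (normIm_le _).
rewrite dotBl dotZl (dotxx hdot).
have : complex.Im (dot (T x) x) = 0.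
  have : dot (T x) x = conjc (dot (T x) x) by rewrite {1}(proj2 Tsa) dotC.
  by case: (dot (T x) x) => a b [] /= h; lra.
case: (dot (T x) x) => a b /= ->; case: z z0 => c d /= _.
by rewrite mulr0 !add0r normrN normrM [`|_ ^+ 2|]ger0_norm ?sqr_ge0 // expr2.
Qed.

Lemma bounded_below_comp (S1 S2 : H -> H) :
  bounded_below S1 -> bounded_below S2 -> bounded_below (S1 \o S2).
Proof.
move=> [d d0 h] [e e0 k]; exists (d * e) => [|x]; first exact: mulr_gt0.
apply: le_trans (h _); rewrite -mulrA ler_wpM2l //; exact: ltW.
Qed.

Lemma bounded_below_prod (r : seq R[i]) :
  (forall z, z \in r -> bounded_below (fun x => T x - z *: x)) ->
  bounded_below (polyop T (\prod_(z <- r) ('X - z%:P))).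
Proof.
elim: r => [|z r IH] hr.
  rewrite big_nil; exists 1 => // x.
  by rewrite polyopC scale1r mul1r.
rewrite big_cons.
have -> : polyop T (('X - z%:P) * \prod_(j <- r) ('X - j%:P)) =
    (fun x => T x - z *: x) \o polyop T (\prod_(j <- r) ('X - j%:P)).
  apply/funext => x /=; rewrite polyopM; last exact: self_adjoint_linear.
  by rewrite polyopB polyopX polyopC.
apply: bounded_below_comp; first by apply: hr; rewrite mem_head.
by apply: IH => y yr; apply: hr; rewrite in_cons yr orbT.
Qed.

(** Split q into linear factors over the complex numbers: if T - z were bounded below for every root
    z, so would be the composite q(T). A root z for which this fails is real by
    [bounded_below_imaginary]. *)
Lemma polyop_root_approx q : q != 0 -> ~ bounded_below (polyop T q) ->
  exists2 t : R, approx_spectrum T t & q.[t%:C] = 0.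
Proof.
move=> q0 nq; have [r qr] := closed_field_poly_normal q.
have l0 : lead_coef q != 0 by rewrite lead_coef_eq0.
have [z [zr nz]] : exists z, z \in r /\ ~ bounded_below (fun x => T x - z *: x).
  apply: contrapT => h; apply: nq.
  have [|d d0 hd] := @bounded_below_prod r.
    by move=> z zr; apply: contrapT => h'; apply: h; exists z.
  exists (rnorm (lead_coef q) * d); first by rewrite mulr_gt0 // rnorm_gt0.
  by move=> x; rewrite [in leRHS]qr polyopZ rnormZ -mulrA ler_wpM2l ?rnorm_ge0.
have iz : complex.Im z = 0.
  by apply/eqP; apply: contraT => /bounded_below_imaginary.
have ez : z = (complex.Re z)%:C by case: z iz {zr nz} => a b /= ->.
exists (complex.Re z); first by rewrite /approx_spectrum /= -ez.
rewrite -ez; apply/rootP.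
by rewrite [X in root X _]qr rootZ // root_prod_XsubC.
Qed.

(* With N the norm of p(T), the operator q(T) for q = conj(p) p - N^2 is not
   bounded below, so some root of q lies in the approximate spectrum; there
   |p| = N. *)
Lemma polyop_norm p (M : R) (t0 : R) : approx_spectrum T t0 ->
  (forall t, approx_spectrum T t -> rnorm p.[t%:C] <= M) ->
  bounded_by (polyop T p) M.
Proof.
move=> At0 pM; have M0 : 0 <= M by apply: le_trans (pM _ At0); apply: rnorm_ge0.
(* The infimum of [P] is the operator norm of p(T), and is itself a bound ([pN]). *)
pose P := [set K : R | 0 <= K /\ bounded_by (polyop T p) K].
have [linp [K1 K10 K1b]] := proj1 (bounded_operatorP _) (polyop_bounded p).
have hP : has_inf P.
  by split; [exists K1; split|exists 0 => K []].
pose N := inf P.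
have N0 : 0 <= N by apply: lb_le_inf; [exact: proj1 hP | move=> K []].
have pN : bounded_by (polyop T p) N.
  move=> x; apply/ler_addgt0Pr => e e0.
  have n1 : 0 < rnorm x + 1 by rewrite ltr_wpDl ?rnorm_ge0.
  have [K [K0 KP] KN] := inf_adherent (divr_gt0 e0 n1) hP.
  apply: le_trans (KP x) _.
  apply: le_trans (_ : (N + e / (rnorm x + 1)) * rnorm x <= _).
    by rewrite ler_wpM2r ?rnorm_ge0 // ltW.
  rewrite mulrDl lerD2l mulrAC ler_pdivrMr // ler_pM2l //; lra.
have [NM|MN] := leP N M.
  by move=> x; apply: le_trans (pN x) _; rewrite ler_wpM2r ?rnorm_ge0.
have {}N0 : 0 < N by apply: le_lt_trans MN.
exfalso; pose q := map_poly conjC p * p - ((N ^+ 2)%:C)%:P.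
have qE (t : R) : q.[t%:C] = (rnorm p.[t%:C] ^+ 2 - N ^+ 2)%:C.
  rewrite /q hornerD hornerN hornerM hornerC horner_conj mulrC mul_conjE.
  by rewrite -rmorphB.
have qN0 (t : R) : approx_spectrum T t -> q.[t%:C] != 0.
  move=> At; rewrite qE; apply/eqP => /(@complexI _ _ 0)/eqP; rewrite subr_eq0.
  apply/negP; rewrite lt_eqF // ltr_pXn2r ?nnegrE ?rnorm_ge0 ?(ltW N0) //.
  exact: le_lt_trans (pM _ At) MN.
have [||t At qt] := @polyop_root_approx q; last first.
- by have := qN0 _ At; rewrite qt eqxx.
- move=> [d d0 hd].
  (* With y = p(T)x, expand |q(T)x|^2 and use |p(T)y| <= N |y|: then d^2 |x|^2 <= N^4 |x|^2 - N^2
     |y|^2. This bounds p(T) by a constant smaller than N, against minimality. *)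
  have key x : (N * rnorm (polyop T p x)) ^+ 2 <= (N ^+ 4 - d ^+ 2) * rnorm x ^+ 2.
    pose y := polyop T p x.
    have e1 : polyop T q x = polyop T (map_poly conjC p) y - (N ^+ 2)%:C *: x.
      by rewrite polyopB polyopM ?polyopC //; exact: self_adjoint_linear.
    have e2 : rnorm (polyop T q x) ^+ 2 =
       rnorm (polyop T p y) ^+ 2 - 2 * N ^+ 2 * rnorm y ^+ 2 + N ^+ 4 * rnorm x ^+ 2.
      apply: complexI; rewrite -(dotxx hdot) e1 dotBl !dotBr !dotZl !dotZr conjCR.
      rewrite (dotxx hdot) rnorm_polyop_conj (dotxx hdot x).
      have -> : dot (polyop T (map_poly conjC p) y) x = (rnorm y ^+ 2)%:C.
        by rewrite polyop_adj conj_polyK (dotxx hdot).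
      have -> : dot x (polyop T (map_poly conjC p) y) = (rnorm y ^+ 2)%:C.
        by rewrite -polyop_adj (dotxx hdot).
      by rewrite -!rmorphM -!rmorphB; congr (_%:C); ring.
    have h1 : (d * rnorm x) ^+ 2 <= rnorm (polyop T q x) ^+ 2.
      by rewrite ler_pXn2r ?nnegrE ?rnorm_ge0 // mulr_ge0 ?rnorm_ge0 // ltW.
    have h2 : rnorm (polyop T p y) ^+ 2 <= (N * rnorm y) ^+ 2.
      by rewrite ler_pXn2r ?nnegrE ?rnorm_ge0 // mulr_ge0 ?rnorm_ge0 // ltW.
    rewrite e2 in h1; rewrite exprMn in h1; rewrite exprMn in h2.
    by rewrite exprMn -/y; lra.
  pose m := Num.max 0 (N ^+ 4 - d ^+ 2).
  have m0 : 0 <= m by rewrite le_max lexx.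
  have mN : m < N ^+ 4.
    by rewrite gt_max exprn_gt0 //= ltrBlDr ltrDl exprn_gt0.
  have : N <= Num.sqrt m / N.
    apply: ge_inf; first by exists 0 => K [].
    split; first by rewrite divr_ge0 ?sqrtr_ge0 // ltW.
    move=> x; rewrite mulrAC ler_pdivlMr // mulrC.
    rewrite -(@ler_pXn2r _ 2) ?nnegrE ?mulr_ge0 ?rnorm_ge0 ?sqrtr_ge0 ?(ltW N0) //.
    apply: le_trans (key x) _; rewrite exprMn sqr_sqrtr //.
    by rewrite ler_wpM2r ?exprn_ge0 ?rnorm_ge0 // le_max lexx orbT.
  rewrite ler_pdivlMr // -expr2 => h.
  suff : m < m by rewrite ltxx.
  apply: lt_le_trans mN _; rewrite -[leRHS]sqr_sqrtr // (exprM _ 2 2).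
  by rewrite ler_pXn2r ?nnegrE ?exprn_ge0 ?sqrtr_ge0 // ltW.
(* The point [t0] of the approximate spectrum shows that q is not the zero polynomial. *)
- by apply: contraNneq (qN0 _ At0) => ->; rewrite horner0.
Qed.

(** An inverse of T - t bounded by K gives |x| <= K |(T - t)x|. The constant K + 1 replaces K, which
    may be 0. *)
Lemma approx_spectrum_sub : approx_spectrum T `<=` real_spectrum T.
Proof.
move=> t nb [S [/bounded_operatorP[_ [K K0 SK]] ST _]]; apply: nb.
have K1 : 0 < K + 1 by rewrite ltr_wpDl.
exists (K + 1)^-1 => [|x]; first by rewrite invr_gt0.
rewrite mulrC ler_pdivrMr // -{1}(ST x); apply: le_trans (SK _) _.
by rewrite mulrC ler_wpM2l ?rnorm_ge0 // lerDl.
Qed.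

Lemma approx_spectrum_bounded :
  exists2 K : R, 0 < K & forall t, approx_spectrum T t -> `|t| <= K.
Proof.
have [_ [K K0 TK]] := proj1 (bounded_operatorP _) (proj1 Tsa).
exists (K + 1) => [|t At]; first by rewrite ltr_wpDl.
apply: contrapT => /negP; rewrite -ltNge => tK; apply: At.
exists 1 => // x; have := rnorm_dist (t%:C *: x) 0 (T x).
rewrite !subr0 rnormZ rnormC [rnorm (_ - T x)]rnormB => h.
have := TK x; have : (K + 1) * rnorm x <= `|t| * rnorm x.
  by rewrite ler_wpM2r ?rnorm_ge0 // ltW.
lra.
Qed.

(** A lower bound d for T - t leaves the lower bound d / 2 for T - s when |s - t| < d / 2. *)
Lemma approx_spectrum_closed : closed (approx_spectrum T).
Proof.
move=> t ct; move=> [d d0 hd].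
have d2 : 0 < d / 2 by rewrite divr_gt0.
have [s [As /= st]] := ct _ (nbhsx_ballx t _ d2).
apply: As; exists (d / 2) => // x.
have := rnorm_dist (T x - t%:C *: x) 0 (T x - s%:C *: x).
have -> : T x - t%:C *: x - (T x - s%:C *: x) = (s - t)%:C *: x.
  by rewrite rmorphB /= scalerBl opprB addrC addrA subrK.
rewrite !subr0.
rewrite rnormZ rnormC; have := hd x.
have : `|s - t| * rnorm x <= d / 2 * rnorm x.
  by rewrite ler_wpM2r ?rnorm_ge0 // distrC ltW.
lra.
Qed.

End SelfAdjoint.

(** * Polynomial approximation *)

(* The sum of 'C(n, k) u^k (1 - u)^(n - k) f k, by Pascal's recurrence. *)
Fixpoint bernstein {R : comNzRingType} (u : {poly R}) n (f : nat -> R) : {poly R} :=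
  if n is m.+1 then
    u * bernstein u m (fun k => f k.+1) + (1 - u) * bernstein u m f
  else (f 0%N)%:P.

Section Weierstrass.
Context {R : realType}.

(* The factor of D is the second moment about c of a binomial law. *)
Lemma bernstein_bound (u : {poly R}) n (f : nat -> R) (a C D c x : R) :
  0 <= u.[x] <= 1 ->
  (forall k, (k <= n)%N -> `|f k - a| <= C + D * (k%:R - c) ^+ 2) ->
  `|(bernstein u n f).[x] - a| <=
    C + D * (n%:R * u.[x] * (1 - u.[x]) + (n%:R * u.[x] - c) ^+ 2).
Proof.
move=> /andP[u0 u1]; elim: n f c => [|n IH] f c hf /=.
  by rewrite hornerC !mul0r add0r; exact: hf.
(* The recurrence conditions on one trial: a success shifts k, and with it the centre c, by one. The
   two bounds, weighted by v and 1 - v, add up exactly to the bound for n + 1. *)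
have h1 := IH (fun k => f k.+1) (c - 1).
have h2 := IH f c.
have {}h1 : `|(bernstein u n (fun k => f k.+1)).[x] - a| <=
    C + D * (n%:R * u.[x] * (1 - u.[x]) + (n%:R * u.[x] - (c - 1)) ^+ 2).
  apply: h1 => k kn; have -> : k%:R - (c - 1) = k.+1%:R - c :> R.
    by rewrite -natr1; ring.
  exact: hf.
have {}h2 : `|(bernstein u n f).[x] - a| <=
    C + D * (n%:R * u.[x] * (1 - u.[x]) + (n%:R * u.[x] - c) ^+ 2).
  by apply: h2 => k kn; apply: hf; apply: leq_trans kn _.
rewrite hornerD !hornerM hornerD hornerN hornerC.
set b1 := (bernstein _ _ _).[x] in h1 *; set b2 := (bernstein _ _ _).[x] in h2 *.
set v := u.[x] in u0 u1 h1 h2 *.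
have -> : v * b1 + (1 - v) * b2 - a = v * (b1 - a) + (1 - v) * (b2 - a) by ring.
apply: le_trans (ler_normD _ _) _.
rewrite !normrM (ger0_norm u0) (@ger0_norm _ (1 - v)) ?subr_ge0 //.
have {}h1 := ler_wpM2l u0 h1.
have v1 : 0 <= 1 - v by rewrite subr_ge0.
have {}h2 := ler_wpM2l v1 h2.
apply: le_trans (lerD h1 h2) _; rewrite -natr1 le_eqVlt; apply/orP; left.
by apply/eqP; ring.
Qed.

(** Heine-Cantor theorem, by the near-covering form of compactness. Only [x] is confined to the
    segment, so that later the Bernstein nodes need not be located in it. *)
Lemma unif_modulus (g : R -> R) (L e : R) : continuous g -> 0 < e ->
  exists2 d : R, 0 < d & forall x y, `|x| <= L -> `|x - y| < d -> `|g x - g y| <= e.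
Proof.
move=> cg e0; pose P (d x : R) := forall y, `|x - y| < d -> `|g x - g y| <= e.
have e2 : 0 < e / 2 by rewrite divr_gt0.
have hx (x : R) : [set` `[- L, L]] x -> \forall x' \near x & d \near 0^'+, P d x'.
  move=> _; have /cvgrPdist_lt/(_ _ e2) := cg x.
  move=> /nbhs_normP[r /= r0 hr].
  have r2 : 0 < r / 2 by rewrite divr_gt0.
  have h (z : R) : `|x - z| < r -> `|g x - g z| < e / 2 by move=> /hr.
  near=> z d => y /= zy.
  have xz : `|x - z| < r / 2.
    near: z; exact: (nbhsx_ballx x _ r2).
  have dr : d < r / 2 by near: d; exact: nbhs_right_lt.
  have h1 : `|x - y| < r.
    have := ler_distD z x y. lra.
  have h2 : `|x - z| < r by lra.
  have := ler_distD (g x) (g z) (g y); rewrite [`|g z - g x|]distrC.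
  by have := h _ h1; have := h _ h2; lra.
have := @segment_compact R (- L) L; rewrite compact_near_coveringP.
move=> /(_ R 0^'+ P _ hx) hP.
have [d [d0 hd]] := filter_ex (filterI (nbhs_right_gt 0) hP).
exists d => // x y xL xy; apply: hd => //=.
by rewrite in_itv /= -ler_norml.
Unshelve. all: by end_near. Qed.

Lemma weierstrass_bounded (g : R -> R) (L M e : R) : 0 < L -> continuous g ->
  (forall x, `|g x| <= M) -> 0 < e ->
  exists p : {poly R}, forall x, `|x| <= L -> `|g x - p.[x]| <= e.
Proof.
move=> L0 cg gM e0.
have M0 : 0 <= M by apply: le_trans (gM 0).
have e2 : 0 < e / 2 by rewrite divr_gt0.
have [d d0 hd] := unif_modulus L cg e2.
(* Chebyshev's argument: at a node at distance at least d from x the error 2M is at most 2M |x - y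
   k|^2 / d^2, which equals D / N^2 times (k - N u)^2. The binomial variance N u (1 - u) turns this
   into at most D / N, and n is chosen to make D / N at most e / 2; nodes nearer than d cost the
   other e / 2. *)
pose D := 2 * M / d ^+ 2 * (2 * L) ^+ 2.
have D0 : 0 <= D by apply: mulr_ge0; rewrite ?sqr_ge0 // divr_ge0 ?sqr_ge0 // mulr_ge0.
have [n nD] : exists n : nat, D / (e / 2) < n.+1%:R.
  exists (Num.bound (D / (e / 2))).
  have h := archi_boundP (divr_ge0 D0 (ltW e2)).
  by apply: lt_trans h _; rewrite ltr_nat.
set N : R := n.+1%:R in nD.
have N0 : 0 < N by rewrite ltr0n.
pose u : {poly R} := (2 * L)^-1 *: ('X + L%:P).
pose y k : R := - L + 2 * L * (k%:R / N).
exists (bernstein u n.+1 (fun k => g (y k))) => x xL; rewrite distrC.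
have uE : u.[x] = (x + L) / (2 * L) by rewrite /u hornerZ hornerD hornerX hornerC mulrC.
have [xL1 xL2] : - L <= x /\ x <= L by apply/andP; rewrite -ler_norml.
have u01 : 0 <= u.[x] <= 1.
  by rewrite uE ler_pdivrMr ?ler_pdivlMr; lra.
apply: le_trans (@bernstein_bound u n.+1 _ (g x) (e / 2) (D / N ^+ 2)
  (N * u.[x]) x u01 _) _.
  move=> k kn; have [h|h] := ltP (`|x - y k|) d.
    rewrite distrC; apply: le_trans (hd _ _ xL h) _; rewrite lerDl.
    by rewrite mulr_ge0 ?sqr_ge0 ?divr_ge0 // exprn_ge0 // ltW.
  apply: le_trans (_ : D / N ^+ 2 * (k%:R - N * u.[x]) ^+ 2 <= _); last first.
    by rewrite lerDr ltW.
  have -> : D / N ^+ 2 * (k%:R - N * u.[x]) ^+ 2 = 2 * M * (`|x - y k| ^+ 2 / d ^+ 2).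
    rewrite real_normK ?num_real // /D /y uE.
    by field; rewrite !gt_eqF.
  apply: le_trans (ler_normB _ _) _.
  have : 1 <= `|x - y k| ^+ 2 / d ^+ 2.
    by rewrite ler_pdivlMr ?exprn_gt0 // mul1r ler_pXn2r // nnegrE ltW.
  have := gM x; have := gM (y k) => h1 h2 h3.
  apply: le_trans (_ : 2 * M * 1 <= _); first lra.
  by rewrite ler_wpM2l // mulr_ge0.
rewrite subrr expr0n addr0 -/N.
have -> : D / N ^+ 2 * (N * u.[x] * (1 - u.[x])) = D / N * (u.[x] * (1 - u.[x])).
  by field; rewrite gt_eqF.
have : u.[x] * (1 - u.[x]) <= 1 by move: u01 => /andP[? ?]; nra.
have : D / N <= e / 2.
  by rewrite ler_pdivrMr // mulrC -ler_pdivrMr // ltW.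
have : 0 <= D / N by rewrite divr_ge0 // ltW.
move=> h1 h2 h3.
rewrite [leRHS]splitr lerD2l; apply: le_trans h2.
by rewrite ler_piMr.
Qed.

(** On the compact set A the function is bounded, so its Tietze extension can be taken bounded on
    the whole line, as [weierstrass_bounded] requires. *)
Lemma weierstrass (A : set R) (L : R) (g : R -> R) (e : R) :
  closed A -> (forall t, A t -> `|t| <= L) -> 0 < L ->
  {within A, continuous g} -> 0 < e ->
  exists p : {poly R}, forall t, A t -> `|g t - p.[t]| <= e.
Proof.
move=> cA AL L0 cg e0.
have kA : compact A.
  apply: (subclosed_compact cA (@segment_compact R (- L) L)) => t /AL.
  by rewrite /= in_itv /= -ler_norml.
have /compact_bounded[M [_ hM]] := continuous_compact cg kA.
have M1 : 0 < `|M| + 1 by rewrite ltr_wpDl.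
have gM t : A t -> `|g t| <= `|M| + 1.
  move=> At; apply: hM; last by exists t.
  by rewrite ltr_pwDr // ler_norm.
have [h [gh ch hb]] :=
  continuous_bounded_extension (@pseudometric_normal _ _) cA M1 cg gM.
have [p hp] := weierstrass_bounded L0 ch hb e0.
by exists p => t At; rewrite gh ?inE //; apply: hp; exact: AL.
Qed.

Lemma continuous_Re : continuous (fun z : R[i]^o => complex.Re z : R).
Proof.
move=> z; apply/(@cvgrPdist_le _ _ _ (nbhs (z : R[i]^o))
  (@nbhs_filter (R[i]^o) z)) => e e0.
have := @near_rnorm _ (R[i]^o) z _ e0; apply: (@filterS _ (nbhs (z : R[i]^o)) _) => y.
by rewrite -raddfB /=; apply: le_trans (normRe_le _).
Qed.

Lemma continuous_Im : continuous (fun z : R[i]^o => complex.Im z : R).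
Proof.
move=> z; apply/(@cvgrPdist_le _ _ _ (nbhs (z : R[i]^o))
  (@nbhs_filter (R[i]^o) z)) => e e0.
have := @near_rnorm _ (R[i]^o) z _ e0; apply: (@filterS _ (nbhs (z : R[i]^o)) _) => y.
by rewrite -raddfB /=; apply: le_trans (normIm_le _).
Qed.

Lemma continuous_complex (a b : R -> R) x :
  {for x, continuous a} -> {for x, continuous b} ->
  {for x, continuous (fun t => (a t +i* b t : R[i]^o))}.
Proof.
move=> ca cb; apply/cvgrPdist_le => e e0.
have er : (complex.Re e)%:C = e by apply: RRe_real; exact: gtr0_real.
have re0 : 0 < complex.Re e by rewrite -ltcR er.
have e2 : 0 < complex.Re e / 2 by rewrite divr_gt0.
move/cvgrPdist_le/(_ _ e2) : ca => ca; move/cvgrPdist_le/(_ _ e2) : cb => cb.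
near=> y; rewrite -er -rnorm_le; apply: le_trans (rnorm_le_ReIm _) _.
rewrite [leRHS]splitr; apply: lerD => /=; by near: y.
Unshelve. all: by end_near. Qed.

Lemma weierstrass_complex (A : set R) (L : R) (f : R -> R[i]) (e : R) :
  closed A -> (forall t, A t -> `|t| <= L) -> 0 < L ->
  continuous_on A f -> 0 < e ->
  exists p : {poly R[i]}, forall t, A t -> rnorm (f t - p.[t%:C]) <= e.
Proof.
move=> cA AL L0 cf e0; have e2 : 0 < e / 2 by rewrite divr_gt0.
have cRe : {within A, continuous (fun t => complex.Re (f t))}.
  by move=> x; apply: continuous_comp (cf x) _; exact: continuous_Re.
have cIm : {within A, continuous (fun t => complex.Im (f t))}.
  by move=> x; apply: continuous_comp (cf x) _; exact: continuous_Im.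
have [p hp] := weierstrass cA AL L0 cRe e2.
have [q hq] := weierstrass cA AL L0 cIm e2.
exists (map_poly (real_complex R) p + 'i%C *: map_poly (real_complex R) q) => t At.
rewrite hornerD hornerZ !horner_map /=.
rewrite [e]splitr; apply: le_trans (rnorm_le_ReIm _) _.
have := hp t At; have := hq t At; case: (f t) => a b /=.
rewrite !(mul0r, mul1r, mulr0, add0r, addr0, subr0, oppr0) => h1 h2.
by apply: lerD.
Qed.

End Weierstrass.

(** * Existence of the continuous functional calculus *)

Section Calculus.
Context {R : realType} {H : completeNormedModType R[i]} {dot : {dot H for conjC}}.
Hypothesis hdot : hilbert_form dot.
Variable T : H -> H.
Hypothesis Tsa : self_adjoint dot T.
Variable t0 : R.
Hypothesis At0 : approx_spectrum T t0.
Local Notation A := (approx_spectrum T).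
Implicit Types (p q : {poly R[i]}) (f g : R -> R[i]) (S : H -> H).

Definition close_to f p (e : R) := forall t, A t -> rnorm (f t - p.[t%:C]) <= e.

Definition approximable f := forall e, 0 < e -> exists p, close_to f p e.

(** Characterises S = f(T) by all polynomial approximations of f at once instead of one chosen
    sequence, so that properties of the calculus can be checked one polynomial at a time. *)
Definition represents f S :=
  forall p e, close_to f p e -> bounded_by (fun x => S x - polyop T p x) e.

Lemma close_to_polyop f p q d e : close_to f p d -> close_to f q e ->
  bounded_by (fun x => polyop T p x - polyop T q x) (d + e).
Proof.
move=> fp fq x; rewrite -polyopB; apply: (polyop_norm hdot Tsa At0) => t At.
rewrite hornerD hornerN; apply: le_trans (rnorm_dist _ _ (f t)) _.
by rewrite rnormB; apply: lerD; [apply: fp|apply: fq].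
Qed.

(** One good polynomial per error suffices: by [close_to_polyop] any other approximation q of f
    gives an operator close to the one from p. *)
Lemma representsI f S :
  (forall e, 0 < e -> exists2 p, close_to f p e &
     bounded_by (fun x => S x - polyop T p x) e) -> represents f S.
Proof.
move=> h q e fq x; apply/ler_addgt0Pr => d d0.
have n1 : 0 < 2 * (rnorm x + 1) by rewrite mulr_gt0 // ltr_wpDl ?rnorm_ge0.
have d1 := divr_gt0 d0 n1; set d2 := d / _ in d1.
have [p fp Sp] := h _ d1.
apply: le_trans (rnorm_dist _ _ (polyop T p x)) _.
have := Sp x; have := close_to_polyop fp fq x => h1 h2.
apply: le_trans (lerD h2 h1) _.
have h3 : d2 * (2 * (rnorm x + 1)) = d by rewrite divfK // gt_eqF.
by rewrite -[in leRHS]h3; have := ltW d1; lra.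
Qed.

Lemma represents_unique f S1 S2 : approximable f ->
  represents f S1 -> represents f S2 -> S1 =1 S2.
Proof.
move=> af h1 h2 x; apply/eqP; rewrite -subr_eq0; apply/eqP.
apply: (@rnorm_eps0 _ _ _ (2 * rnorm x)) => e e0.
have [p fp] := af _ e0.
apply: le_trans (rnorm_dist _ _ (polyop T p x)) _.
by have := h1 _ _ fp x; have := h2 _ _ fp x; rewrite [rnorm (_ - S2 x)]rnormB; lra.
Qed.

(** S is the pointwise limit of p_n(T), where p_n is within 1 / (n + 1) of f. The comparison [ple]
    with an arbitrary approximation q makes the sequence Cauchy, and passes to its limit. *)
Lemma represents_ex f : approximable f -> exists S, represents f S.
Proof.
move=> af; have /choice[p hp] : forall n : nat, exists p, close_to f p n.+1%:R^-1.
  by move=> n; apply: af; rewrite invr_gt0.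
have ple (x : H) (e : R) : 0 < e ->
    \forall n \near \oo, forall q d, close_to f q d ->
    rnorm (polyop T q x - polyop T (p n) x) <= d * rnorm x + e.
  move=> e0; have n1 : 0 < rnorm x + 1 by rewrite ltr_wpDl ?rnorm_ge0.
  have := near_infty_natSinv_lt (PosNum (divr_gt0 e0 n1)).
  apply: filterS => n /= hn q d fq.
  apply: le_trans (close_to_polyop fq (hp n) x) _.
  rewrite mulrDl lerD2l; apply: le_trans (_ : n.+1%:R^-1 * (rnorm x + 1) <= _).
    by rewrite ler_wpM2l ?invr_ge0 // lerDl.
  by rewrite -ler_pdivlMr // ltW.
have cv (x : H) : cvg (polyop T (p n) x @[n --> \oo]).
  apply/cauchy_cvgP/cauchy_exP => e e0.
  have er : (complex.Re e)%:C = e by apply: RRe_real; exact: gtr0_real.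
  have re0 : 0 < complex.Re e by rewrite -ltcR er.
  have e4 : 0 < complex.Re e / 4 by rewrite divr_gt0.
  have n1 : 0 < rnorm x + 1 by rewrite ltr_wpDl ?rnorm_ge0.
  have h1 := near_infty_natSinv_lt (PosNum (divr_gt0 e4 n1)).
  have [m /= hm] := filter_ex h1.
  exists (polyop T (p m) x); have := ple x _ e4; apply: filterS => n hn /=.
  rewrite -ball_normE /ball_ /= -er norm_rnorm ltcR.
  apply: le_lt_trans (hn _ _ (hp m)) _.
  have : m.+1%:R^-1 * rnorm x <= complex.Re e / 4.
    apply: le_trans (_ : m.+1%:R^-1 * (rnorm x + 1) <= _).
      by rewrite ler_wpM2l ?invr_ge0 // lerDl.
    by rewrite -ler_pdivlMr // ltW.
  by move: (_ * rnorm x) => a; lra.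
exists (fun x => lim (polyop T (p n) x @[n --> \oo])) => q d fq x.
apply/ler_addgt0Pr => e e0; rewrite rnormB.
apply: (cvg_unique_rnorm (cv x)).
by have := ple x _ e0; apply: filterS => n; apply.
Qed.

Lemma represents_norm f S (M : R) : approximable f -> represents f S ->
  (forall t, A t -> rnorm (f t) <= M) -> bounded_by S M.
Proof.
move=> af fS fM x; apply/ler_addgt0Pr => d d0.
have n1 : 0 < 2 * (rnorm x + 1) by rewrite mulr_gt0 // ltr_wpDl ?rnorm_ge0.
have d1 := divr_gt0 d0 n1; set e := d / _ in d1.
have [p fp] := af _ d1.
have h1 := fS _ _ fp x.
have h2 : rnorm (polyop T p x) <= (M + e) * rnorm x.
  apply: (polyop_norm hdot Tsa At0) => t At.
  have := fM t At; have := fp t At; have := rnorm_dist p.[t%:C] 0 (f t).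
  by rewrite !subr0 rnormB; lra.
have := rnorm_dist (S x) 0 (polyop T p x); rewrite !subr0.
have h3 : e * (2 * (rnorm x + 1)) = d by rewrite divfK // gt_eqF.
by rewrite -[X in _ -> _ <= _ + X]h3; have := ltW d1; lra.
Qed.

Lemma horner_bounded p (K : R) :
  exists2 C : R, 0 <= C & forall t : R, `|t| <= K -> rnorm p.[t%:C] <= C.
Proof.
elim/poly_ind: p => [|p c [C C0 hC]].
  by exists 0 => // t _; rewrite horner0 rnorm0.
exists (C * `|K| + rnorm c); first by rewrite addr_ge0 ?mulr_ge0 ?rnorm_ge0.
move=> t tK; rewrite hornerD hornerM hornerX hornerC.
apply: le_trans (rnormD _ _) _; rewrite lerD2r rnormM rnormC.
by apply: ler_pM; rewrite ?rnorm_ge0 ?hC // (le_trans tK) // ler_norm.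
Qed.

Lemma approximable_bounded f : approximable f ->
  exists2 C : R, 0 <= C & forall t, A t -> rnorm (f t) <= C.
Proof.
move=> /(_ 1 ltr01)[p fp].
have [K _ AK] := approx_spectrum_bounded Tsa.
have [C C0 hC] := horner_bounded p K.
exists (C + 1) => [|t At]; first by rewrite addr_ge0.
have := hC t (AK t At); have := fp t At; have := rnorm_dist (f t) 0 (p.[t%:C]).
by rewrite !subr0; lra.
Qed.

(** S inherits linearity from p(T) up to e times a quantity independent of e; a bound of |f| on the
    approximate spectrum bounds S. *)
Lemma represents_bounded f S : approximable f -> represents f S -> bounded_operator S.
Proof.
move=> af fS; apply/bounded_operatorP; split.
  move=> a x y; apply/eqP; rewrite -subr_eq0; apply/eqP.
  apply: (@rnorm_eps0 _ _ _ (rnorm (a *: x + y) + (rnorm a * rnorm x + rnorm y))) => e e0.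
  have [p fp] := af _ e0.
  have h z := fS _ _ fp z.
  have lp : linear (polyop T p) by case: (polyop_bounded Tsa p).
  rewrite mulrDr.
  apply: le_trans (rnorm_dist _ _ (polyop T p (a *: x + y))) _; apply: lerD => //.
  rewrite lp rnormB opprD addrACA -scalerBr.
  apply: le_trans (rnormD _ _) _; rewrite mulrDr; apply: lerD => //.
  by rewrite rnormZ mulrCA ler_wpM2l ?rnorm_ge0.
have [C C0 fC] := approximable_bounded af.
by exists C => //; apply: represents_norm fS fC.
Qed.

Lemma representsD f g S1 S2 : approximable f -> approximable g ->
  represents f S1 -> represents g S2 ->
  approximable (fun t => f t + g t) /\
  represents (fun t => f t + g t) (fun x => S1 x + S2 x).
Proof.
move=> af ag h1 h2.
have key e : 0 < e -> exists2 p, close_to (fun t => f t + g t) p e &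
     bounded_by (fun x => S1 x + S2 x - polyop T p x) e.
  move=> e0; have e2 : 0 < e / 2 by rewrite divr_gt0.
  have [p fp] := af _ e2; have [q gq] := ag _ e2.
  exists (p + q) => [t At|x].
    rewrite hornerD opprD addrACA [e]splitr.
    by apply: le_trans (rnormD _ _) _; apply: lerD; [apply: fp|apply: gq].
  rewrite polyopD opprD addrACA [e]splitr mulrDl.
  by apply: le_trans (rnormD _ _) _; apply: lerD; [apply: h1|apply: h2].
split; last exact: representsI.
by move=> e /key[p hp _]; exists p.
Qed.

Lemma representsZ f S z : approximable f -> represents f S ->
  approximable (fun t => z * f t) /\
  represents (fun t => z * f t) (fun x => z *: S x).
Proof.
move=> af h1.
have key e : 0 < e -> exists2 p, close_to (fun t => z * f t) p e &
     bounded_by (fun x => z *: S x - polyop T p x) e.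
  move=> e0; have n1 : 0 < rnorm z + 1 by rewrite ltr_wpDl ?rnorm_ge0.
  have e2 := divr_gt0 e0 n1.
  have [p fp] := af _ e2; have ze : rnorm z * (e / (rnorm z + 1)) <= e.
    by rewrite mulrCA ler_piMr ?(ltW e0) // ler_pdivrMr // mul1r lerDl.
  exists (z *: p) => [t At|x].
    rewrite hornerZ -mulrBr rnormM; apply: le_trans ze.
    by rewrite ler_wpM2l ?rnorm_ge0 // fp.
  rewrite polyopZ -scalerBr rnormZ.
  apply: le_trans (_ : rnorm z * (e / (rnorm z + 1) * rnorm x) <= _).
    by rewrite ler_wpM2l ?rnorm_ge0 // h1.
  by rewrite mulrA ler_wpM2r ?rnorm_ge0.
split; last exact: representsI.
by move=> e /key[p hp _]; exists p.
Qed.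

Lemma representsM f g S1 S2 : approximable f -> approximable g ->
  represents f S1 -> represents g S2 ->
  approximable (fun t => f t * g t) /\
  represents (fun t => f t * g t) (fun x => S1 (S2 x)).
Proof.
move=> af ag h1 h2.
have [C C0 fC] := approximable_bounded af.
have [D D0 gD] := approximable_bounded ag.
have key e : 0 < e -> exists2 p, close_to (fun t => f t * g t) p e &
     bounded_by (fun x => S1 (S2 x) - polyop T p x) e.
  move=> e0; have n1 : 0 < C + D + 1 by rewrite ltr_wpDl // addr_ge0.
  (* As d <= 1, |p| <= C + 1 and |q| <= D + 1. Both f g - p q and S1 S2 - p(T) q(T), split through a
     mixed product, then have error at most d (C + D + 1). *)
  pose d := Num.min 1 (e / (C + D + 1)).
  have d0 : 0 < d by rewrite lt_min ltr01 divr_gt0.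
  have d1 : d <= 1 by rewrite ge_min lexx.
  have de : d * (C + D + 1) <= e.
    by rewrite -ler_pdivlMr // ge_min lexx orbT.
  have [p fp] := af _ d0; have [q gq] := ag _ d0.
  exists (p * q) => [t At|x].
    rewrite hornerM; apply: le_trans (rnorm_dist _ _ (f t * q.[t%:C])) _.
    rewrite -mulrBr -mulrBl !rnormM.
    have hq : rnorm q.[t%:C] <= D + 1.
      have := rnorm_dist q.[t%:C] 0 (g t); rewrite !subr0 rnormB.
      by have := gD t At; have := gq t At; lra.
    have k1 : rnorm (f t) * rnorm (g t - q.[t%:C]) <= C * d.
      by apply: ler_pM; rewrite ?rnorm_ge0 ?fC ?gq.
    have k2 : rnorm (f t - p.[t%:C]) * rnorm q.[t%:C] <= d * (D + 1).
      by apply: ler_pM; rewrite ?rnorm_ge0 ?fp.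
    by lra.
  rewrite (polyopM (self_adjoint_linear Tsa)).
  apply: le_trans (rnorm_dist _ _ (polyop T p (S2 x))) _.
  have k0 : rnorm (S2 x) <= D * rnorm x by apply: represents_norm h2 gD _.
  have k1 := h1 _ _ fp (S2 x).
  have lp : linear (polyop T p) by case: (polyop_bounded Tsa p).
  rewrite -(linearpB lp).
  have k2 : rnorm (polyop T p (S2 x - polyop T q x)) <=
      (C + 1) * rnorm (S2 x - polyop T q x).
    apply: (polyop_norm hdot Tsa At0) => t At.
    have := rnorm_dist p.[t%:C] 0 (f t); rewrite !subr0 rnormB.
    by have := fC t At; have := fp t At; lra.
  have k3 := ler_wpM2l (addr_ge0 C0 ler01) (h2 _ _ gq x).
  have k4 := ler_wpM2l (ltW d0) k0.
  have k5 := ler_wpM2r (rnorm_ge0 x) de.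
  by lra.
split; last exact: representsI.
by move=> e /key[p hp _]; exists p.
Qed.

Lemma represents_adj f S1 S2 : approximable f -> represents f S1 ->
  represents (fun t => conjC (f t)) S2 -> adjoint_to dot S1 S2.
Proof.
move=> af h1 h2 x y; apply/eqP; rewrite -subr_eq0; apply/eqP.
apply: (@rnorm_eps0 _ _ _ (2 * (rnorm x * rnorm y))) => e e0.
have [p fp] := af _ e0.
have fp' : close_to (fun t => conjC (f t)) (map_poly conjC p) e.
  by move=> t At; rewrite horner_conj -rmorphB rnormJ fp.
have k1 := h1 _ _ fp x; have k2 := h2 _ _ fp' y.
apply: le_trans (rnorm_dist _ _ (dot (polyop T p x) y)) _.
rewrite -dotBl (polyop_adj Tsa) -dotBr.
have m1 := le_trans (dot_CS hdot _ _) (ler_wpM2r (rnorm_ge0 y) k1).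
rewrite rnormB in k2.
have m2 := le_trans (dot_CS hdot _ _) (ler_wpM2l (rnorm_ge0 x) k2).
by have := lerD m1 m2; lra.
Qed.

Lemma approximable_conj f : approximable f -> approximable (fun t => conjC (f t)).
Proof.
move=> af e e0; have [p fp] := af _ e0; exists (map_poly conjC p) => t At.
by rewrite horner_conj -rmorphB rnormJ fp.
Qed.

Lemma represents_poly p :
  approximable (fun t => p.[t%:C]) /\ represents (fun t => p.[t%:C]) (polyop T p).
Proof.
have key e : 0 < e -> exists2 q, close_to (fun t => p.[t%:C]) q e &
     bounded_by (fun x => polyop T p x - polyop T q x) e.
  move=> e0; exists p => [t At|x]; rewrite subrr rnorm0; first exact: ltW.
  by rewrite mulr_ge0 ?rnorm_ge0 // ltW.
split; last exact: representsI.
by move=> e /key[q hp _]; exists q.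
Qed.

Lemma continuous_approximable f :
  continuous_on (real_spectrum T) f -> approximable f.
Proof.
move=> cf e e0; have [K K0 AK] := approx_spectrum_bounded Tsa.
apply: (weierstrass_complex (@approx_spectrum_closed _ _ T) AK K0 _ e0).
by apply: continuous_subspaceW cf; exact: approx_spectrum_sub.
Qed.

(** Each algebraic identity holds because both sides represent the same function, and an
    approximable function is represented by only one operator. *)
Lemma continuous_calculus_ex : exists Phi, is_continuous_calculus dot T Phi.
Proof.
(* On functions that are not approximable the value is arbitrary; the record only constrains
   functions continuous on the spectrum, and these are approximable. *)
pose Phi f := xget (fun=> 0) [set S | represents f S].
have PhiP f : approximable f -> represents f (Phi f).
  by move=> /represents_ex h; apply: (xgetPex (fun=> 0) h).
have Phi_eq f S : approximable f -> represents f S -> forall x, Phi f x = S x.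
  by move=> af fS x; apply: (represents_unique af) fS x; apply: PhiP.
have cA := continuous_approximable.
exists Phi; split.
- by move=> f /cA af; apply: represents_bounded (PhiP _ af).
- move=> f g /cA af /cA ag fg x; apply: Phi_eq => // p e fp.
  apply: PhiP => // t At; rewrite -fg; first exact: fp.
  exact: approx_spectrum_sub.
- move=> f g /cA af /cA ag x.
  by have [h1 h2] := representsD af ag (PhiP _ af) (PhiP _ ag); apply: Phi_eq h2 _.
- move=> z f /cA af x.
  by have [h1 h2] := representsZ z af (PhiP _ af); apply: Phi_eq h2 _.
- move=> f g /cA af /cA ag x.
  by have [h1 h2] := representsM af ag (PhiP _ af) (PhiP _ ag); apply: Phi_eq h2 _.
- move=> x; have [h1 h2] := represents_poly 1.
  have -> : (fun=> 1) = (fun t : R => (1 : {poly R[i]}).[t%:C]).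
    by apply/funext => t; rewrite hornerC.
  by rewrite (Phi_eq _ _ h1 h2) polyopC scale1r.
- move=> f /cA af; apply: (represents_adj af); first exact: PhiP.
  by apply: PhiP; exact: approximable_conj.
- move=> x; have [h1 h2] := represents_poly 'X.
  have -> : (fun t => t%:C) = (fun t : R => ('X : {poly R[i]}).[t%:C]).
    by apply/funext => t; rewrite hornerX.
  by rewrite (Phi_eq _ _ h1 h2) polyopX.
- move=> f M M0 /cA af fM x; rewrite norm_rnorm (norm_rnorm x) -rmorphM lecR.
  apply: (represents_norm af (PhiP _ af)) => t /approx_spectrum_sub /fM.
  by rewrite norm_rnorm lecR.
Qed.

End Calculus.

(** * Rapidly decaying matrices *)

Section InverseSquares.
Context {R : realType}.
Local Notation w k := ((1 + k)%:R : R).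

Lemma weight_gt0 k : 0 < w k.
Proof. by rewrite ltr0n. Qed.

(** Telescoping: 1 / (x + 1)^2 <= 1 / x - 1 / (x + 1), so the partial sums stay below 2 - 1 / w
    m. *)
Lemma sum_inverse_squares n : \sum_(k < n) (w k)^-2 <= 2.
Proof.
have key m : \sum_(k < m.+1) (w k)^-2 <= 2 - (w m)^-1.
  elim: m => [|m IH]; first by rewrite big_ord1 expr1n invr1; lra.
  rewrite big_ord_recr /=; apply: le_trans (lerD IH (lexx _)) _.
  have h0 := weight_gt0 m; have h1 : w m.+1 = w m + 1 by rewrite addnS natr1.
  rewrite h1 -subr_ge0.
  have -> : 2 - (w m + 1)^-1 - (2 - (w m)^-1 + (w m + 1) ^-2) =
     (w m)^-1 * (w m + 1) ^-2.
    by field; rewrite gt_eqF //= gt_eqF // ltr_wpDl ?ltW.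
  by rewrite mulr_ge0 ?invr_ge0 ?exprn_ge0 ?addr_ge0 ?ler01 // ltW.
case: n => [|m]; first by rewrite big_ord0.
by apply: le_trans (key m) _; rewrite gerBl invr_ge0 ltW ?weight_gt0.
Qed.

Lemma rapidly_decayingP (a : nat -> nat -> R[i]) :
  rapidly_decaying a <-> forall M N, exists B : R, forall k l,
    w k ^+ M * w l ^+ N * rnorm (a k l) <= B.
Proof.
have e M N k l : (1 + k)%:R ^+ M * (1 + l)%:R ^+ N * `|a k l| =
    (w k ^+ M * w l ^+ N * rnorm (a k l))%:C.
  by rewrite norm_rnorm !rmorphM !rmorphXn /= !rmorph_nat.
split=> h M N; have [B hB] := h M N; exists B => k l; have := hB k l.
  by rewrite e lecR.
by rewrite e lecR.
Qed.

Lemma double_sum_bound m (B : R) (d : nat -> nat -> R) : 0 <= B ->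
  (forall k l, d k l <= B * (w k)^-2 * (w l)^-2) ->
  \sum_(k < m) \sum_(l < m) d k l <= 4 * B.
Proof.
move=> B0 dB.
apply: le_trans (_ : \sum_(k < m) (2 * B) * (w k)^-2 <= _); last first.
  rewrite -mulr_sumr; have := ler_wpM2l (mulr_ge0 (ler0n _ 2) B0) (sum_inverse_squares m).
  by move=> /le_trans; apply; lra.
apply: ler_sum => k _.
apply: le_trans (_ : \sum_(l < m) B * (w k)^-2 * (w l)^-2 <= _).
  by apply: ler_sum.
rewrite -mulr_sumr [2 * B]mulrC -[leRHS]mulrA [2 * _]mulrC mulrA.
apply: ler_wpM2l (sum_inverse_squares m).
by rewrite mulr_ge0 // invr_ge0 exprn_ge0.
Qed.
End InverseSquares.

(** * Square truncations and matrix coefficients in the basis *)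

Section SmoothCompact.
Context {R : realType} {H : completeNormedModType R[i]} {dot : {dot H for conjC}}.
Hypothesis hdot : hilbert_form dot.
Variable E : nat -> H.
Hypothesis hE : orthonormal_basis dot E.
Local Notation w k := ((1 + k)%:R : R).
Implicit Types (a : nat -> nat -> R[i]) (S : H -> H).

Definition trunc a n x := \sum_(k < n) \sum_(l < n) a k l *: matrix_unit dot E k l x.

Definition proj n (x : H) := \sum_(k < n) dot x (E k) *: E k.

Lemma rnorm_basis k : rnorm (E k) = 1.
Proof.
apply: (@pexpIrn _ 2) => //; rewrite ?nnegrE ?rnorm_ge0 //.
by apply: complexI; rewrite -(dotxx hdot) (proj1 hE) eqxx expr1n.
Qed.

Lemma trunc_basis a n l : (l < n)%N -> trunc a n (E l) = \sum_(k < n) a k l *: E k.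
Proof.
move=> ln; apply: eq_bigr => k _; rewrite (bigD1 (Ordinal ln)) //= big1 ?addr0.
  by rewrite /matrix_unit (proj1 hE) eqxx scale1r.
move=> i /negPf il; rewrite /matrix_unit (proj1 hE) eq_sym.
by rewrite (il : (i == l :> nat) = false) !scale0r scaler0.
Qed.

Lemma dot_proj n x k : (k < n)%N -> dot (proj n x) (E k) = dot x (E k).
Proof.
move=> kn; rewrite /proj dot_suml (bigD1 (Ordinal kn)) //= big1 ?addr0.
  by rewrite dotZl (proj1 hE) eqxx mulr1.
move=> i /negPf il; rewrite dotZl (proj1 hE).
by rewrite (il : (i == k :> nat) = false) mulr0.
Qed.

(** With P the projection, |Px|^2 = <Px, x> <= |Px| |x|. *)
Lemma rnorm_proj n x : rnorm (proj n x) <= rnorm x.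
Proof.
have h : dot (proj n x) (proj n x) = dot (proj n x) x.
  rewrite {1 3}/proj !dot_suml; apply: eq_bigr => k _.
  by rewrite !dotZl (dotC (proj n x)) dot_proj // -dotC.
have [->|p0] := eqVneq (proj n x) 0; first by rewrite rnorm0 rnorm_ge0.
rewrite -(ler_pM2l (rnorm_gt0 p0)); apply: le_trans (dot_CS hdot _ _).
by rewrite -h (dotxx hdot) rnormC ger0_norm ?sqr_ge0 // expr2.
Qed.

Lemma proj_cvg x : proj n x @[n --> \oo] --> x.
Proof.
rewrite (_ : (fun n => proj n x) = series (fun k => dot x (E k) *: E k)).
  exact: (proj2 hE).
by apply/funext => n; rewrite /series /= big_mkord.
Qed.

Lemma trunc_cvg a S : opnorm_cvg (trunc a) S ->
  forall x, trunc a n x @[n --> \oo] --> S x.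
Proof.
move=> h x; apply/cvg_rnormP => e e0.
have n1 : 0 < rnorm x + 1 by rewrite ltr_wpDl ?rnorm_ge0.
have := h _ (divr_gt0 e0 n1); apply: filterS => n /(_ x).
rewrite norm_rnorm (norm_rnorm x) -rmorphM lecR rnormB => /le_trans; apply.
by rewrite mulrAC ler_pdivrMr // ler_pM2l // lerDl.
Qed.

(** The (k, l) entry of the n-th truncation is exactly [a k l] once n exceeds k and l, and matrix
    entries pass to the limit. *)
Lemma trunc_coef a S k l : opnorm_cvg (trunc a) S -> dot (S (E l)) (E k) = a k l.
Proof.
move=> /trunc_cvg /(_ (E l)) /(dot_cvgl hdot (y := E k)) /cvg_rnormP h.
apply/eqP; rewrite -subr_eq0; apply/eqP/(@rnorm_eps0 _ _ _ 1) => e e0.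
have hn := nbhs_infty_gt (maxn k l).
have [n [h1]] := filter_ex (filterI (h _ e0) hn).
rewrite /= gtn_max => /andP[kn ln]; rewrite mulr1.
suff <- : dot (trunc a n (E l)) (E k) = a k l by [].
rewrite trunc_basis // dot_suml (bigD1 (Ordinal kn)) //= big1 ?addr0.
  by rewrite dotZl (proj1 hE) eqxx mulr1.
move=> i /negPf il; rewrite dotZl (proj1 hE).
by rewrite (il : (i == k :> nat) = false) mulr0.
Qed.

Lemma rapid_basis_image a S : rapidly_decaying a -> opnorm_cvg (trunc a) S ->
  forall N, exists2 B : R, 0 <= B & forall l, w l ^+ N * rnorm (S (E l)) <= B.
Proof.
(* Two orders of decay in k are spent on summing S E_l over the basis; the N orders in l remain. *)
move=> /rapidly_decayingP ra aS N; have [B hB] := ra 2%N N.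
have B0 : 0 <= B.
  apply: le_trans (hB 0%N 0%N).
  by rewrite !mulr_ge0 ?rnorm_ge0 // exprn_ge0.
exists (2 * B) => [|l]; first by rewrite mulr_ge0.
have wl : 0 < w l ^+ N by rewrite exprn_gt0 // weight_gt0.
rewrite mulrC -ler_pdivlMr //.
have := @cvg_unique_rnorm _ _ _ _ (2 * B / w l ^+ N) 0 (trunc_cvg aS (x := E l)).
rewrite sub0r rnormN; apply.
have := nbhs_infty_gt l; apply: filterS => n ln.
rewrite sub0r rnormN trunc_basis //.
apply: le_trans (rnorm_sum _ _ _) _.
apply: le_trans (_ : \sum_(k < n) (B / w l ^+ N) * (w k)^-2 <= _).
  apply: ler_sum => k _; rewrite rnormZ rnorm_basis mulr1.
  rewrite ler_pdivlMr ?exprn_gt0 ?weight_gt0 // ler_pdivlMr //.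
  by have := hB k l; rewrite mulrC -mulrA mulrCA mulrC.
rewrite -mulr_sumr; apply: le_trans (_ : B / w l ^+ N * 2 <= _).
  by apply: ler_wpM2l (sum_inverse_squares n); rewrite divr_ge0 // ltW.
by rewrite mulrC mulrA.
Qed.

(** Truncating the matrix of S compresses S to P S P, with P the projection on the first n basis
    vectors; this yields strong convergence for every bounded S. *)
Lemma trunc_proj S n x : bounded_operator S ->
  trunc (fun k l => dot (S (E l)) (E k)) n x = proj n (S (proj n x)).
Proof.
move=> [linS _]; apply: eq_bigr => k _.
rewrite /proj (linearp_sum linS) dot_suml scaler_suml.
apply: eq_bigr => l _.
by rewrite /matrix_unit (linearpZ linS) dotZl scalerA mulrC.
Qed.

Lemma trunc_proj_cvg S x : bounded_operator S ->
  trunc (fun k l => dot (S (E l)) (E k)) n x @[n --> \oo] --> S x.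
Proof.
move=> bS; have /bounded_operatorP[linS [K K0 SK]] := bS.
apply/cvg_rnormP => e e0.
have e2 : 0 < e / 2 by rewrite divr_gt0.
have K1 : 0 < K + 1 by rewrite ltr_wpDl.
have h1 := proj1 (cvg_rnormP _ _) (proj_cvg (x := S x)) _ e2.
have h2 := proj1 (cvg_rnormP _ _) (proj_cvg (x := x)) _ (divr_gt0 e2 K1).
apply: filterS (filterI h1 h2) => n [k1 k2].
rewrite trunc_proj //; apply: le_trans (rnorm_dist _ _ (proj n (S x))) _.
rewrite [e]splitr; apply: lerD => //.
have lp : linear (proj n).
  move=> z u v; rewrite /proj scaler_sumr -big_split /=.
  by apply: eq_bigr => k _; rewrite dotDl dotZl scalerDl scalerA.
rewrite -(linearpB lp) -(linearpB linS).
apply: le_trans (rnorm_proj _ _) _; apply: le_trans (SK _) _.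
apply: le_trans (_ : (K + 1) * rnorm (x - proj n x) <= _).
  by rewrite ler_wpM2r ?rnorm_ge0 // lerDl.
by rewrite mulrC -ler_pdivlMr.
Qed.

Lemma rnorm_trunc (d : nat -> nat -> R[i]) m x :
  rnorm (trunc d m x) <= (\sum_(k < m) \sum_(l < m) rnorm (d k l)) * rnorm x.
Proof.
rewrite mulr_suml; apply: le_trans (rnorm_sum _ _ _) _; apply: ler_sum => k _.
rewrite mulr_suml; apply: le_trans (rnorm_sum _ _ _) _; apply: ler_sum => l _.
rewrite !rnormZ rnorm_basis mulr1 ler_wpM2l ?rnorm_ge0 //.
by apply: le_trans (dot_CS hdot _ _) _; rewrite rnorm_basis mulr1.
Qed.

Lemma trunc_widen a n m x : (n <= m)%N ->
  trunc a n x = trunc (fun k l => if (k < n)%N && (l < n)%N then a k l else 0) m x.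
Proof.
move=> nm; rewrite /trunc.
rewrite (big_ord_widen m (fun k => \sum_(l < n) a k l *: matrix_unit dot E k l x)) //.
rewrite big_mkcond; apply: eq_bigr => k _; case: ifP => kn /=; last first.
  by rewrite big1 // => l _; rewrite scale0r.
rewrite (big_ord_widen m (fun l => a k l *: matrix_unit dot E k l x)) //.
rewrite big_mkcond; apply: eq_bigr => l _; case: ifP => // _.
by rewrite scale0r.
Qed.

(** The truncations converge strongly to S; [tail] makes them Cauchy in operator norm, and letting m
    tend to infinity in it upgrades the convergence. *)
Lemma smooth_compactI S : bounded_operator S ->
  rapidly_decaying (fun k l => dot (S (E l)) (E k)) -> smooth_compact dot E S.
Proof.
move=> bS rb; split=> //; exists (fun k l => dot (S (E l)) (E k)); split=> //.
set b := fun k l => _ in rb *.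
(* Two orders in each index make the double sum converge. The third pays for the factor 1 / w n:
   outside the n by n square k or l is at least n, so w n <= w k * w l. *)
have [B hB] := proj1 (rapidly_decayingP _) rb 3%N 3%N.
have B0 : 0 <= B.
  apply: le_trans (hB 0%N 0%N).
  by rewrite !mulr_ge0 ?rnorm_ge0 // exprn_ge0.
have tail n m x : (n <= m)%N ->
    rnorm (trunc b n x - trunc b m x) <= 4 * (B / w n) * rnorm x.
  move=> nm; pose d k l := if (k < n)%N && (l < n)%N then 0 else b k l.
  have -> : trunc b n x - trunc b m x = - trunc d m x.
    rewrite (trunc_widen b x nm) /trunc -sumrB -sumrN; apply: eq_bigr => k _.
    rewrite -sumrB -sumrN; apply: eq_bigr => l _; rewrite -scalerBl -scaleNr /d.
    by case: ifP => _; rewrite ?subrr ?oppr0 ?sub0r.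
  rewrite rnormN; apply: le_trans (rnorm_trunc _ _ _) _.
  apply: ler_wpM2r; first exact: rnorm_ge0.
  have wn := @weight_gt0 R n.
  apply: (@double_sum_bound _ _ _ (fun k l => rnorm (d k l))) => [|k l].
    by rewrite divr_ge0 // ltW.
  have wk := @weight_gt0 R k; have wl := @weight_gt0 R l.
  rewrite /d; case: ifP => [_|/negbT].
    by rewrite rnorm0 !mulr_ge0 ?invr_ge0 ?exprn_ge0 // ltW.
  rewrite negb_and -!leqNgt => kl.
  have wkl : w n <= w k * w l.
    rewrite -natrM ler_nat; case/orP: kl => [nk|nl].
      by apply: leq_trans (leq_pmulr _ _) => //; rewrite leq_add2l.
    by apply: leq_trans (leq_pmull _ _) => //; rewrite leq_add2l.
  rewrite ler_pdivlMr ?exprn_gt0 // ler_pdivlMr ?exprn_gt0 // ler_pdivlMr //.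
  apply: le_trans (hB k l).
  have -> : rnorm (b k l) * w l ^+ 2 * w k ^+ 2 * w n =
    (w k ^+ 2 * w l ^+ 2 * rnorm (b k l)) * w n by ring.
  have -> : w k ^+ 3 * w l ^+ 3 * rnorm (b k l) =
    (w k ^+ 2 * w l ^+ 2 * rnorm (b k l)) * (w k * w l) by ring.
  by rewrite ler_wpM2l // !mulr_ge0 ?exprn_ge0 ?rnorm_ge0 // ltW.
move=> e e0.
have e1 : 0 < e / (4 * B + 1) by rewrite divr_gt0 // ltr_wpDl // mulr_ge0.
have := near_infty_natSinv_lt (PosNum e1); apply: filterS => n /= hn x.
rewrite norm_rnorm (norm_rnorm x) -rmorphM lecR.
apply: (cvg_unique_rnorm (trunc_proj_cvg bS (x := x))).
have := nbhs_infty_ge n; apply: filterS => m nm.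
apply: le_trans (tail n m x nm) _; apply: ler_wpM2r; first exact: rnorm_ge0.
rewrite mulrA; apply: le_trans (_ : (4 * B + 1) * n.+1%:R^-1 <= _).
  by rewrite ler_wpM2r ?invr_ge0 // lerDl.
by rewrite mulrC -ler_pdivlMr ?ltr_wpDl ?mulr_ge0 // ltW.
Qed.

Lemma approx_spectrum0 a c : rapidly_decaying a -> opnorm_cvg (trunc a) c ->
  approx_spectrum c 0.
Proof.
move=> ra ac [d d0 hd]; have [B B0 hB] := rapid_basis_image ra ac 1%N.
have e1 : 0 < d / (B + 1) by rewrite divr_gt0 // ltr_wpDl.
have [l hl] := filter_ex (near_infty_natSinv_lt (PosNum e1)).
have := hd (E l); rewrite scale0r subr0 rnorm_basis mulr1 => h.
have := hB l; rewrite expr1; have wl := @weight_gt0 R l.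
rewrite /= ltr_pdivlMr ?ltr_wpDl // mulrC ltr_pdivrMr // in hl.
have h' := ler_wpM2l (ltW wl) h; rewrite mulrC in hl.
by rewrite -[l.+1]add1n in hl; lra.
Qed.

End SmoothCompact.

(** * Second-order Taylor quotients *)

Section SecondOrderQuotient.
Context {R : realType}.
Implicit Types (phi : R -> R).

(* The value at 0 is the limit, by Taylor's formula when phi 0 = 0. *)
Definition quotient2 phi (t : R) : R :=
  if t == 0 then derive1 (derive1 phi) 0 / 2 else (phi t - derive1 phi 0 * t) / t ^+ 2.

Lemma quotient2E phi t : phi 0 = 0 ->
  phi t = derive1 phi 0 * t + quotient2 phi t * t ^+ 2.
Proof.
rewrite /quotient2; case: eqVneq => [-> ->|t0 _]; first by rewrite expr0n !mulr0 addr0.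
by rewrite divfK ?expf_neq0 // addrC subrK.
Qed.

Lemma derivable_for_continuous phi t : derivable phi t 1 -> {for t, continuous phi}.
Proof. by move=> /derivable1_diffP; apply: differentiable_continuous. Qed.

Lemma MVT_from0 (q dq : R -> R) (s : R) :
  (forall x : R, `|x| <= `|s| -> is_derive x 1 q (dq x)) ->
  exists2 c, `|c| <= `|s| & q s - q 0 = dq c * s.
Proof.
move=> dE.
have cq x : `|x| <= `|s| -> {for x, continuous q}.
  by move=> /dE [h _]; apply: derivable_for_continuous.
have [s0|s0] := leP 0 s.
  have [||c] := @MVT_segment _ q dq 0 s s0.
  - move=> x; rewrite in_itv /= => /andP[x0 xs]; apply: dE.
    by rewrite !ger0_norm // ltW.
  - apply: continuous_in_subspaceT => x; rewrite inE /= in_itv /= => /andP[x0 xs].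
    by apply: cq; rewrite !ger0_norm.
  rewrite in_itv /= => /andP[c0 cs] e; exists c; first by rewrite !ger0_norm.
  by rewrite e subr0.
have [||c] := @MVT_segment _ q dq s 0 (ltW s0).
- move=> x; rewrite in_itv /= => /andP[sx x0]; apply: dE.
  by rewrite !ltr0_norm // lerN2 ltW.
- apply: continuous_in_subspaceT => x; rewrite inE /= in_itv /= => /andP[sx x0].
  by apply: cq; rewrite (ltr0_norm s0) ler0_norm // lerN2.
rewrite in_itv /= => /andP[sc c0] e; exists c.
  by rewrite (ltr0_norm s0) ler0_norm // lerN2.
by rewrite -opprB e sub0r mulrN opprK.
Qed.

(** The limit of the difference quotient with its denominator cleared, so that s = 0 is included. *)
Lemma derive1_expansion phi (e : R) : derivable phi 0 1 -> 0 < e ->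
  \forall s \near 0, `|phi s - phi 0 - derive1 phi 0 * s| <= e * `|s|.
Proof.
move=> dphi e0.
have /cvgrPdist_le/(_ _ e0) :
  (fun h : R => h^-1 *: ((phi \o shift 0) (h *: 1) - phi 0)) @ 0^' -->
    'D_1 phi 0 := dphi.
rewrite -derive1E near_withinE; apply: filterS => s hs.
have [->|s0] := eqVneq s 0; first by rewrite subrr mulr0 subr0 !normr0 mulr0.
have := hs s0; rewrite /= addr0 /GRing.scale /= mulr1 => h.
have -> : phi s - phi 0 - derive1 phi 0 * s =
    - (derive1 phi 0 - s^-1 * (phi s - phi 0)) * s by field.
by rewrite normrM normrN ler_wpM2r.
Qed.

Lemma quotient2_continuous (U : set R) phi t : open U -> U 0 -> U t -> phi 0 = 0 ->
  (forall x, U x -> derivable phi x 1) -> derivable (derive1 phi) 0 1 ->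
  {for t, continuous (quotient2 phi)}.
Proof.
move=> oU U0 Ut p0 dphi ddphi; have [->|t0] := eqVneq t 0; last first.
  have cphi := derivable_for_continuous (dphi _ Ut).
  apply/(cvg_trans _ (_ :
    (phi s - derive1 phi 0 * s) / s ^+ 2 @[s --> t] --> quotient2 phi t)).
    apply: near_eq_cvg; near=> s; rewrite /quotient2 ifF //; apply/negbTE.
    near: s; exact: (cvgr_neq0 _ cvg_id t0).
  rewrite /quotient2 (negPf t0); apply: cvgM.
    by apply: cvgB => //; apply: cvgM; [exact: cvg_cst|exact: cvg_id].
  by apply: cvgV; [rewrite expf_neq0|exact: exprn_continuous].
apply/cvgrPdist_le => e e0.
have h1 := derive1_expansion ddphi e0.
have h2 : \forall s \near 0, U s by exact: open_nbhs_nbhs.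
set L := derive1 (derive1 phi) 0 in h1.
have h : nbhs (0 : R) [set s |
  `|derive1 phi s - derive1 phi 0 - L * s| <= e * `|s| /\ U s] by exact: filterI.
have [d /= d0 hd] := proj1 (nbhs_ballP (0 : R) _) h.
near=> s; have sd : `|s| < d.
  rewrite -normrN -sub0r; near: s; exact: (nbhsx_ballx (0 : R) d d0).
have [->|s0] := eqVneq s 0; first by rewrite subrr normr0 ltW.
(* [q] is the Taylor remainder, and q s / s^2 is the increment of the quotient. Its derivative [dq]
   is o(x) by the expansion of phi' at 0, so the mean value theorem gives |q s| <= e s^2. *)
pose q x := phi x - derive1 phi 0 * x - L / 2 * x ^+ 2.
pose dq x := derive1 phi x - derive1 phi 0 - L * x.
have [|c cs qs] := @MVT_from0 q dq s.
  move=> x xs; have Ux : U x.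
    by apply: (proj2 (hd x _)); rewrite /ball /= sub0r normrN (le_lt_trans xs).
  have dx : is_derive x 1 phi (derive1 phi x).
    by rewrite derive1E; apply: DeriveDef => //; exact: dphi.
  rewrite /q /dq.
  by apply: is_derive_eq; rewrite /GRing.scale /=; field.
have q0 : q 0 = 0 by rewrite /q p0 expr0n /= !mulr0 !subr0.
rewrite q0 subr0 in qs.
have dqc : `|dq c| <= e * `|s|.
  apply: le_trans (_ : e * `|c| <= _); last by rewrite ler_wpM2l // ltW.
  by apply: (proj1 (hd c _)); rewrite /ball /= sub0r normrN (le_lt_trans cs).
have s2 : 0 < s ^+ 2 by rewrite exprn_even_gt0.
have -> : quotient2 phi 0 - quotient2 phi s = - (q s / s ^+ 2).
  rewrite /quotient2 eqxx (negPf s0) /q -/L; field.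
  by rewrite s0.
rewrite normrN normrM normfV (gtr0_norm s2) ler_pdivrMr //.
rewrite qs normrM -(real_normK (num_real s)) expr2 mulrA.
by rewrite ler_wpM2r.
Unshelve. all: by end_near. Qed.

End SecondOrderQuotient.

Section SmoothQuotient.
Context {R : realType}.

(** Continuity through real and imaginary parts, matching the form of [smooth_on]. *)
Definition ReIm_continuous (f : R -> R[i]) (t : R) :=
  {for t, continuous (fun s => complex.Re (f s))} /\
  {for t, continuous (fun s => complex.Im (f s))}.

Lemma ReIm_continuousM (f g : R -> R[i]) t :
  ReIm_continuous f t -> ReIm_continuous g t -> ReIm_continuous (fun s => f s * g s) t.
Proof.
move=> [f1 f2] [g1 g2]; split.
  rewrite (_ : (fun s => _) = fun s => complex.Re (f s) * complex.Re (g s) -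
      complex.Im (f s) * complex.Im (g s)).
    by apply: cvgB; apply: cvgM.
  by apply/funext => s; case: (f s) (g s) => a b [].
rewrite (_ : (fun s => _) = fun s => complex.Re (f s) * complex.Im (g s) +
    complex.Im (f s) * complex.Re (g s)).
  by apply: cvgD; apply: cvgM.
by apply/funext => s; case: (f s) (g s) => a b [].
Qed.

Lemma ReIm_continuous_real t : ReIm_continuous (fun s => s%:C) t.
Proof. by split; [exact: cvg_id|exact: cvg_cst]. Qed.

Lemma ReIm_continuous_cst z t : ReIm_continuous (fun=> z) t.
Proof. by split; exact: cvg_cst. Qed.

Lemma ReIm_continuous_on (A : set R) (f : R -> R[i]) :
  (forall t, A t -> ReIm_continuous f t) -> continuous_on A f.
Proof.
move=> h; apply: continuous_in_subspaceT => t; rewrite inE => /h[h1 h2].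
rewrite (_ : f = fun t => complex.Re (f t) +i* complex.Im (f t)).
  exact: continuous_complex.
by apply/funext => s; case: (f s).
Qed.

(** The second term is bracketed as t (h(t) t) so that multiplicativity of the calculus yields the
    composite c h(c) c. The identity is algebraic and holds on the whole line; smoothness enters
    only in the continuity of h on U. *)
Lemma smooth_quotient2 (U : set R) (f : R -> R[i]) : open U -> U 0 ->
  smooth_on U f -> f 0 = 0 -> exists (z : R[i]) (h : R -> R[i]),
  (forall t, f t = z * t%:C + t%:C * (h t * t%:C)) /\
  (forall t, U t -> ReIm_continuous h t).
Proof.
move=> oU U0 sf f0; pose u t := complex.Re (f t); pose v t := complex.Im (f t).
exists (derive1 u 0 +i* derive1 v 0), (fun t => quotient2 u t +i* quotient2 v t); split.
  move=> t; have u0 : u 0 = 0 by rewrite /u f0.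
  have v0 : v 0 = 0 by rewrite /v f0.
  have fE : f t = u t +i* v t by rewrite /u /v; case: (f t).
  rewrite fE {1}(quotient2E t u0) {1}(quotient2E t v0).
  by apply/eqP; rewrite eq_complex /=; apply/andP; split; apply/eqP; ring.
move=> t Ut; split => /=.
  apply: (quotient2_continuous oU U0 Ut); first by rewrite /u f0.
    by move=> x Ux; exact: (proj1 (sf 0%N x Ux)).
  exact: (proj1 (sf 1%N 0 U0)).
apply: (quotient2_continuous oU U0 Ut); first by rewrite /v f0.
  by move=> x Ux; exact: (proj2 (sf 0%N x Ux)).
exact: (proj2 (sf 1%N 0 U0)).
Qed.

End SmoothQuotient.

End Development.

Theorem theorem2p13 (R : realType) (H : completeNormedModType R[i])
    (dot : {dot H for conjC}) (E : nat -> H)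
    (hdot : hilbert_form dot) (hE : orthonormal_basis dot E)
    (c : H -> H) (hc : smooth_compact dot E c) (hsa : self_adjoint dot c)
    (U : set R) (hU : open U) (hsp : real_spectrum c `<=` U)
    (f : R -> R[i]) (hf : smooth_on U f) (hf0 : f 0 = 0) :
  smooth_compact dot E (continuous_calculus dot c f).
Proof.
have [cb [a [ra ac]]] := hc.
have A0 : approx_spectrum c 0 := approx_spectrum0 hdot hE ra ac.
(* Since c is not bounded below, 0 is a spectral value and f is smooth near it. *)
have U0 : U 0 by apply: hsp; exact: approx_spectrum_sub.
pose Phi := continuous_calculus dot c.
have PhiP : is_continuous_calculus dot c Phi.
  exact: (@xgetPex _ _ [set Phi | is_continuous_calculus dot c Phi]
    (continuous_calculus_ex hdot hsa A0)).
have [z [h [fE ch]]] := smooth_quotient2 hU U0 hf hf0.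
pose id_ (t : R) : R[i] := t%:C%C.
have ci t : ReIm_continuous id_ t by exact: ReIm_continuous_real.
have cz t : ReIm_continuous (fun=> z) t by exact: ReIm_continuous_cst.
pose A := real_spectrum c.
have Ci : continuous_on A id_ by apply: ReIm_continuous_on => t _; exact: ci.
have Czi : continuous_on A (fun t => z * id_ t).
  by apply: ReIm_continuous_on => t _; apply: ReIm_continuousM.
have Ch : continuous_on A h by apply: ReIm_continuous_on => t /hsp /ch.
have Chi : continuous_on A (fun t => h t * id_ t).
  by apply: ReIm_continuous_on => t /hsp /ch ?; apply: ReIm_continuousM.
have Cihi : continuous_on A (fun t => id_ t * (h t * id_ t)).
  apply: ReIm_continuous_on => t /hsp /ch ?.
  by apply: ReIm_continuousM => //; apply: ReIm_continuousM.
have fE' : f = fun t => z * id_ t + id_ t * (h t * id_ t) by apply/funext => t; exact: fE.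
have PhiE x : Phi f x = z *: c x + c (Phi h (c x)).
  rewrite fE' (calculus_add PhiP Czi Cihi) (calculus_scale PhiP z Ci).
  by rewrite (calculus_mul PhiP Ci Chi) (calculus_mul PhiP Ch Ci) !(calculus_id PhiP).
have hb : bounded_operator (Phi h) by exact: calculus_bounded PhiP _ Ch.
have Phib : bounded_operator (Phi f).
  have -> : Phi f = fun x => z *: c x + (c \o (Phi h \o c)) x.
    by apply/funext => x; rewrite PhiE.
  apply: bounded_operatorD; first exact: bounded_operatorZ.
  by do 2 apply: bounded_operator_comp => //.
apply: (smooth_compactI hdot hE Phib); apply/rapidly_decayingP => M N.
have [B1 hB1] := proj1 (rapidly_decayingP a) ra M N.
have [B2 B20 hB2] := rapid_basis_image hdot hE ra ac M.
have [B3 B30 hB3] := rapid_basis_image hdot hE ra ac N.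
have [_ [K K0 hK]] := proj1 (bounded_operatorP _) hb.
(* [B1] handles z c; in the other term the weight of order M goes with c E_k, that of order N with c
   E_l, and K bounds h(c). *)
exists (rnorm z * B1 + K * (B2 * B3)) => k l.
set wk := (1 + k)%:R ^+ M; set wl := (1 + l)%:R ^+ N.
have wk0 : 0 <= wk :> R by rewrite exprn_ge0.
have wl0 : 0 <= wl :> R by rewrite exprn_ge0.
rewrite PhiE dotDl dotZl (trunc_coef hdot hE k l ac) (proj2 hsa).
apply: le_trans (ler_wpM2l (mulr_ge0 wk0 wl0) (rnormD _ _)) _.
rewrite mulrDr rnormM; apply: lerD.
  by rewrite mulrCA; apply: ler_wpM2l (hB1 k l); exact: rnorm_ge0.
have h1 : rnorm (dot (Phi h (c (E l))) (c (E k))) <=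
    K * (rnorm (c (E l)) * rnorm (c (E k))).
  apply: le_trans (dot_CS hdot _ _) _; rewrite mulrA.
  by apply: ler_wpM2r (hK _); exact: rnorm_ge0.
apply: le_trans (ler_wpM2l (mulr_ge0 wk0 wl0) h1) _.
have -> : wk * wl * (K * (rnorm (c (E l)) * rnorm (c (E k)))) =
  K * ((wk * rnorm (c (E k))) * (wl * rnorm (c (E l)))) by ring.
apply: ler_wpM2l => //; apply: ler_pM (hB2 k) (hB3 l).
  by rewrite mulr_ge0 ?rnorm_ge0.
by rewrite mulr_ge0 ?rnorm_ge0.
Qed.
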